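(* Let $k$ be a field of characteristic $0$, $\widetilde{W}$ a finite reflection group on a finite-dimensional $k$-vector space $\widetilde V$ endowed with its standard grading, $G$ a good normal subgroup of $\widetilde W$, $W=\widetilde W/G$, and $V$ the tangent space to $\widetilde V/G$ at $0$ with the induced grading. Let $V_i$ be the degree $i$ subspace of $V$, $W_i$ the pointwise stabilizer in $W$ of $\bigoplus_{j\neq i}V_j$, and $E_i$ the set (with multiplicities) of degrees of $W_i$ for the standard grading on $V_i$. Then $W=\prod_i W_i$ and $W_i$ is a reflection group on $V_i$. Moreover, $\bigcup_i iE_i$ is the union (with multiplicities) of the set of degrees of $\widetilde W$ and the set of degrees of the relations of $G$.
   Context: A grading on a finite-dimensional $k$-vector space is an algebraic action of $k^\times$ with strictly positive weights; it is standard if all weights are $1$. A reflection is an automorphism $g$ of finite order with $\ker(g-1)$ a hyperplane; a finite linear group is a reflection group if generated by its reflections. For a vector space $V$, $k[V]$ is the symmetric algebra of $V^*$. Put $B=k[\widetilde V]$, $\widetilde V/G=\operatorname{Spec}B^G$, $B^G_+$ the ideal of $B^G$ spanned by homogeneous elements of positive degree, and $V=(B^G_+/(B^G_+)^2)^*$, graded so that $V_i$ is dual to the degree $i$ part of $B^G_+/(B^G_+)^2$. Fix a graded splitting $V^*\to B^G_+$ equivariant under the normalizer of $G$ in $GL(\widetilde V)$; it induces a surjection of graded algebras $A=k[V]\to B^G$ with kernel $I$. $A_+$ is the ideal of positive-degree elements of $A$. $G$ is called good in $\widetilde W$ if $G$ is of complete intersection (the minimal number of generators of $I$ is $\dim V-\dim\widetilde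 V$) and $W$ acts trivially on $I/A_+I$; in that case $W$ is a reflection group on $V$. The degrees of a finite linear group are the degrees (with multiplicity) of a minimal system of homogeneous generators of its algebra of polynomial invariants. The degrees of the relations of $G$ are the weights (degrees, with multiplicity) of the graded space $I/A_+I$. For a multiset $E$, $iE=\{ie: e\in E\}$. *)

(* Defs.v *)
From HB Require Import structures.
From mathcomp Require Export all_boot all_order all_algebra.
From mathcomp Require Export all_fingroup all_solvable all_field all_character.
From mathcomp Require Export mpoly.

Set Implicit Arguments.
Unset Strict Implicit.
Unset Printing Implicit Defensive.

Import GroupScope GRing.Theory.
Local Open Scope ring_scope.

(* A vector space with a chosen basis is 'rV[k]_n, and k[V] is {mpoly k[n]},
   'X_j being the j-th coordinate.  As everywhere in mxrepresentation, groups
   act on row vectors from the right, v |-> v *m M. *)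

Section LinearGroups.

Variable k : fieldType.

(* The action on polynomial functions: (act M p)(v) = p(v *m M). *)
Definition act n (M : 'M[k]_n) (p : {mpoly k[n]}) : {mpoly k[n]} :=
  p \mPo [tuple \sum_(i < n) M i j *: 'X_i | j < n].

(* In a finite group, the finite order of a reflection is automatic. *)
Definition reflection n (M : 'M[k]_n) : bool :=
  (\rank (kermx (M - 1%:M))).+1 == n.

Definition reflection_group (gT : finGroupType) (G : {group gT}) n
    (rG : mx_representation k G n) : Prop :=
  mx_faithful rG /\ G :=: <<[set s in G | reflection (rG s)]>>.

Definition invariant (gT : finGroupType) n (rho : gT -> 'M[k]_n)
    (G : {set gT}) (p : {mpoly k[n]}) : Prop :=
  {in G, forall x, act (rho x) p = p}.

Definition alg_generates n (B : {mpoly k[n]} -> Prop)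
    (s : seq {mpoly k[n]}) : Prop :=
  {in s, forall q, B q} /\
  forall p, B p -> exists q : {mpoly k[size s]}, p = q \mPo in_tuple s.

Definition min_alg_generates n (B : {mpoly k[n]} -> Prop)
    (s : seq {mpoly k[n]}) : Prop :=
  alg_generates B s /\
  forall t, subseq t s -> alg_generates B t -> t = s.

(* E lists (in some order) the degrees of the finite linear group rG. *)
Definition group_degrees (gT : finGroupType) (G : {group gT}) n
    (rG : mx_representation k G n) (E : seq nat) : Prop :=
  exists s : (size E).-tuple {mpoly k[n]},
    min_alg_generates (invariant rG G) s /\
    forall i : 'I_(size E), tnth s i \is (nth 0%N E i).-homog.

End LinearGroups.

Section Ideals.

Variables (k : fieldType) (n : nat).
Implicit Types P Q I : {mpoly k[n]} -> Prop.

(* The product of two ideals: finite sums of products. *)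
Definition ideal_mul P Q (p : {mpoly k[n]}) : Prop :=
  exists s : seq ({mpoly k[n]} * {mpoly k[n]}),
    {in s, forall u, P u.1 /\ Q u.2} /\ p = \sum_(u <- s) u.1 * u.2.

(* For positive weights on the variables, and B a graded subalgebra, the
   elements of positive degree are those without constant term. *)
Definition pos_part (B : {mpoly k[n]} -> Prop) (p : {mpoly k[n]}) : Prop :=
  B p /\ p@_0%MM = 0.

Definition ideal_generates I (r : seq {mpoly k[n]}) : Prop :=
  {in r, forall q, I q} /\
  forall p, I p -> exists c : 'I_(size r) -> {mpoly k[n]},
    p = \sum_(i < size r) c i * r`_i.

Definition min_ngens I (c : nat) : Prop :=
  (exists2 r, size r = c & ideal_generates I r) /\
  (forall r, ideal_generates I r -> (c <= size r)%N).

(* The classes of the s_j form a basis of the quotient space U / U'. *)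
Definition basis_mod (U U' : {mpoly k[n]} -> Prop) m
    (s : 'I_m -> {mpoly k[n]}) : Prop :=
  (forall j, U (s j)) /\
  forall p, U p -> exists! c : 'rV[k]_m, U' (p - \sum_(j < m) c 0 j *: s j).

(* Homogeneity of degree e when 'X_j has weight d j. *)
Definition whomog (d : 'I_n -> nat) (e : nat) (p : {mpoly k[n]}) : Prop :=
  {in msupp p, forall mn : 'X_{1..n}, (\sum_(j < n) d j * mn j)%N = e}.

End Ideals.

Section Tangent.

Variables (k : fieldType) (gT : finGroupType) (Wt G : {group gT}) (n : nat).
Variable rWt : mx_representation k Wt n.

Definition normalizes (M : 'M[k]_n) : Prop :=
  M \in unitmx /\
  {in G, forall g, exists2 h, h \in G & M *m rWt g *m invmx M = rWt h}.

(* B^G_+ and its square, as an ideal of B^G *)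
Definition inv_pos : {mpoly k[n]} -> Prop := pos_part (invariant rWt G).
Definition inv_pos2 : {mpoly k[n]} -> Prop := ideal_mul inv_pos inv_pos.

Variables (m : nat) (d : 'I_m -> nat) (f : m.-tuple {mpoly k[n]}).

(* P is the matrix, in the basis of B^G_+ / (B^G_+)^2 given by the classes of
   the f_j, of the map induced by M; dually, v |-> v *m P is the map induced
   on the tangent space V, with its dual basis. *)
Definition tangent_matrix (M : 'M[k]_n) (P : 'M[k]_m) : Prop :=
  forall j, inv_pos2 (act M (tnth f j) - \sum_(i < m) P i j *: tnth f i).

(* A homogeneous basis of V^* = B^G_+ / (B^G_+)^2, with degrees d, together
   with a graded splitting V^* -> B^G_+ equivariant under the normalizer of G:
   f_j is the image of the j-th basis vector under the splitting, and the
   basis vector itself is the class of f_j. *)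
Definition equivariant_splitting : Prop :=
  [/\ forall j, (0 < d j)%N,
      forall j, tnth f j \is (d j).-homog,
      basis_mod inv_pos inv_pos2 (tnth f) &
      forall M P, normalizes M -> tangent_matrix M P ->
        forall j, act M (tnth f j) = \sum_(i < m) P i j *: tnth f i].

(* The kernel I of A = k[V] -> B^G *)
Definition relations (p : {mpoly k[m]}) : Prop := p \mPo f = 0.

(* A_+ I *)
Definition pos_relations : {mpoly k[m]} -> Prop :=
  ideal_mul (pos_part (fun=> True)) relations.

Definition relation_degrees (R : seq nat) : Prop :=
  exists r : 'I_(size R) -> {mpoly k[m]},
    basis_mod relations pos_relations r /\
    forall j : 'I_(size R), whomog d (nth 0%N R j) (r j).

Variable rV : mx_representation k (Wt / G)%G m.

Definition tangent_action : Prop :=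
  {in Wt, forall x, tangent_matrix (rWt x) (rV (coset G x))}.

Definition complete_intersection : Prop :=
  exists2 c, (n + c)%N = m & min_ngens relations c.

Definition good : Prop :=
  complete_intersection /\
  {in (Wt / G)%G, forall w p,
    relations p -> pos_relations (act (rV w) p - p)}.

Definition homog_part (i : nat) : 'M[k]_m :=
  (\sum_(a < m | d a == i) <<delta_mx 0 a : 'rV[k]_m>>)%MS.

(* Strict upper bound on the degrees occurring in V *)
Definition degree_bound : nat := (\max_(a < m) d a).+1.

Definition homog_compl (i : nat) : 'M[k]_m :=
  (\sum_(j < degree_bound | j != i :> nat) homog_part j)%MS.

(* W_i *)
Definition homog_stab (i : nat) : {group coset_of G} :=
  rstab_group rV (homog_compl i).

(* The representation of W_i on V_i, once V_i is known to be W-stable *)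
Definition homog_repr (i : nat) (hV : mxmodule rV (homog_part i)) :
    mx_representation k (homog_stab i) (\rank (homog_part i)) :=
  subg_repr (submod_repr hV) (rstab_sub rV (homog_compl i)).

End Tangent.

(* Main.v *)
(* By averaging, I is generated by c = dim V - dim Vt homogeneous W-invariant
   elements (graded Nakayama: W acts trivially on I / A_+ I).  By Chevalley's
   theorem for Wt, the invariants of Wt on B are generated by dim Vt elements;
   together with the c relations, W-invariant lifts of these to A generate A^W,
   so that A^W is generated by dim V elements theta.

   This forces W to be generated by its subgroup H of reflections.  By
   Chevalley's theorem for H, A^H is generated by dim V elements psi; write
   theta = Theta(psi) and let D be the determinant of the Jacobian matrix of
   Theta, evaluated at psi.  Averaging over W a function of x that vanishes to
   the first order at x = y and to the second order at x = u y, for u outside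
   H, shows that D divides a power of prod_(u in W \ H) (a - u a) for every
   a in A^H, and (for H = 1) that D divides a product of linear forms.  A linear factor of D would then be the
   equation of a reflecting hyperplane of an element outside H, so D is
   constant, and A^H = A^W by induction on the degree.

   A reflection of W acts on a single V_i, whence the decomposition of W and of
   A^W.  The degrees of two homogeneous systems of dim V generators of A^W
   agree: by the Leibniz formula the Jacobian determinant of one with respect
   to the other contains a non-zero product of partial derivatives, which
   compares degrees along a permutation. *)

From HB Require Import structures.
From Stdlib Require Import Classical.
From mathcomp Require Import zify ring.
Require Import Defs.

Set Implicit Arguments.
Unset Strict Implicit.
Unset Printing Implicit Defensive.

Import GroupScope GRing.Theory.
Local Open Scope ring_scope.

(** * Weights, substitutions and subalgebras *)

Section Weights.
Variable n : nat.

Definition wgt (d : 'I_n -> nat) (mn : 'X_{1..n}) : nat := (\sum_(j < n) d j * mn j)%N.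

Lemma wgt0 d : wgt d 0%MM = 0%N.
Proof. by rewrite /wgt big1 // => j _; rewrite mnm0E muln0. Qed.

Lemma wgtD d : {morph wgt d : a b / (a + b)%MM >-> (a + b)%N}.
Proof.
by move=> a b; rewrite /wgt -big_split; apply: eq_bigr => j _; rewrite mnmDE mulnDr.
Qed.

HB.instance Definition _ d := isMeasure.Build n (wgt d) (wgt0 d) (wgtD d).

Lemma wgtU d i : wgt d U_(i)%MM = d i.
Proof.
rewrite /wgt (bigD1 i) //= mnm1E eqxx muln1 big1 ?addn0 // => j ne.
by rewrite mnm1E eq_sym (negPf ne) muln0.
Qed.
End Weights.

Section Substitution.
Variable k : comNzRingType.

Lemma mpoly_mono_ind n (P : {mpoly k[n]} -> Prop) :
  P 0 -> (forall mn, P 'X_[mn]) -> (forall c p, P p -> P (c *: p)) ->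
  (forall p q, P p -> P q -> P (p + q)) -> forall p, P p.
Proof.
move=> P0 PX PZ PD p; rewrite [p]mpolyE.
by apply: big_ind => // mn _; apply: PZ.
Qed.

Lemma mpoly_induct n (P : {mpoly k[n]} -> Prop) :
  (forall c, P c%:MP) -> (forall i, P 'X_i) ->
  (forall p q, P p -> P q -> P (p + q)) ->
  (forall p q, P p -> P q -> P (p * q)) -> forall p, P p.
Proof.
move=> PC PX PD PM p; rewrite [p]mpolyE.
apply: big_ind => [||mn _]; rewrite -?mpolyC0 //.
rewrite -mul_mpolyC; apply: (PM) => //.
rewrite mpolyXE_id; apply: big_ind => [|p0 q0|i _]; rewrite -?mpolyC1 //; first exact: PM.
elim: (mn i : nat) => [|e IH]; rewrite ?expr0 -?mpolyC1 // exprS; exact: PM.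
Qed.

Lemma comp_mpolyX_tnth n m (f : n.-tuple {mpoly k[m]}) i : 'X_i \mPo f = tnth f i.
Proof. by rewrite comp_mpolyXU -tnth_nth. Qed.

Lemma comp_mpolyA n m l (f : n.-tuple {mpoly k[m]}) (g : m.-tuple {mpoly k[l]}) p :
  (p \mPo f) \mPo g = p \mPo [tuple tnth f i \mPo g | i < n].
Proof.
elim/mpoly_induct: p => [c|i|p q IHp IHq|p q IHp IHq].
- by rewrite !comp_mpolyC.
- by rewrite !comp_mpolyX_tnth tnth_mktuple.
- by rewrite !comp_mpolyD IHp IHq.
- by rewrite !rmorphM /= IHp IHq.
Qed.

Lemma mderiv_comp n m (f : n.-tuple {mpoly k[m]}) p j :
  (p \mPo f)^`M(j) = \sum_(i < n) (p^`M(i) \mPo f) * (tnth f i)^`M(j).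
Proof.
elim/mpoly_induct: p => [c|i|p q IHp IHq|p q IHp IHq].
- rewrite comp_mpolyC mderivC big1 // => i _.
  by rewrite mderivC comp_mpoly0 mul0r.
- rewrite comp_mpolyX_tnth (bigD1 i) //= big1 ?addr0 => [|l ne];
    rewrite mderivX mnm1E.
    by rewrite eqxx scale1r (_ : (_ - _)%MM = 0%MM) ?mpolyX0 ?comp_mpoly1 ?mul1r //;
      apply/mnmP => a; rewrite mnmBE subnn mnm0E.
  by rewrite eq_sym (negPf ne) scale0r comp_mpoly0 mul0r.
- rewrite comp_mpolyD mderivD IHp IHq -big_split; apply: eq_bigr => i _.
  by rewrite mderivD comp_mpolyD mulrDl.
- rewrite rmorphM /= mderivM IHp IHq mulr_suml mulr_sumr -big_split.
  apply: eq_bigr => i _ /=.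
  rewrite mderivM comp_mpolyD !rmorphM /= mulrDl; congr (_ + _); first by rewrite mulrAC.
  by rewrite mulrA.
Qed.

Lemma mderivXU n (i j : 'I_n) : ('X_i : {mpoly k[n]})^`M(j) = (i == j)%:R.
Proof.
rewrite mderivX mnm1E; case: eqP => [->|_]; last by rewrite scale0r.
rewrite scale1r (_ : (_ - _)%MM = 0%MM) ?mpolyX0 //.
by apply/mnmP => a; rewrite mnmBE subnn mnm0E.
Qed.

Lemma mcoeff0_comp n m (f : n.-tuple {mpoly k[m]}) p :
  (forall i, (tnth f i)@_0%MM = 0) -> (p \mPo f)@_0%MM = p@_0%MM.
Proof.
move=> f0; elim/mpoly_induct: p => [c|i|p q IHp IHq|p q IHp IHq].
- by rewrite comp_mpolyC !mcoeffC !eqxx.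
- by rewrite comp_mpolyX_tnth f0 mcoeffX mnm1_eq0.
- by rewrite comp_mpolyD !mcoeffD IHp IHq.
- by rewrite rmorphM /= !rmorphM /= IHp IHq.
Qed.

Lemma pihomog_comp n m (mf : measure n) (mg : measure m)
    (f : n.-tuple {mpoly k[m]}) p e :
  (forall i, tnth f i \is (mf U_(i)%MM).-homog for mg) ->
  pihomog mg e (p \mPo f) = pihomog mf e p \mPo f.
Proof.
move=> hf.
have hX mn : 'X_[mn] \mPo f \is (mf mn).-homog for mg.
  rewrite comp_mpolyX mfE.
  apply: (big_ind2 (fun q e => q \is e.-homog for mg)) => [|p1 e1 p2 e2|i _].
  - exact: dhomog1.
  - exact: dhomogM.
  - by rewrite mulnC; apply: dhomogMn.
elim/mpoly_mono_ind: p => [|mn|c p IH|p q IHp IHq].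
- by rewrite comp_mpoly0 !pihomog0 comp_mpoly0.
- rewrite pihomogX; case: eqP => [<-|/eqP ne]; first by rewrite pihomog_dE.
  by rewrite comp_mpoly0; apply: pihomog_ne0 ne _.
- by rewrite comp_mpolyZ !linearZ /= IH.
- by rewrite comp_mpolyD !pihomogD IHp IHq comp_mpolyD.
Qed.

Lemma pihomogM_mon n (mf : measure n) a b e :
  pihomog mf e ('X_[a] * 'X_[b] : {mpoly k[n]}) =
  \sum_(i < e.+1) pihomog mf i 'X_[a] * pihomog mf (e - i)%N 'X_[b].
Proof.
rewrite -mpolyXD pihomogX mfD; case: eqP => [<-|ne].
  have la : (mf a < (mf a + mf b).+1)%N by rewrite ltnS leq_addr.
  rewrite (bigD1 (Ordinal la)) //= !pihomogX eqxx addKn eqxx -mpolyXD.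
  rewrite big1 ?addr0 // => i; rewrite -val_eqE /= => nei.
  by rewrite pihomogX eq_sym (negPf nei) mul0r.
rewrite big1 // => i _; rewrite !pihomogX.
case: eqP => [ai|]; last by rewrite mul0r.
case: eqP => [bi|]; last by rewrite mulr0.
by case: ne; rewrite ai bi subnKC // -ltnS.
Qed.

Lemma pihomogM n (mf : measure n) (p q : {mpoly k[n]}) e :
  pihomog mf e (p * q) = \sum_(i < e.+1) pihomog mf i p * pihomog mf (e - i)%N q.
Proof.
elim/mpoly_mono_ind: p => [|a|c p IH|p1 p2 IH1 IH2]; first last.
- rewrite mulrDl pihomogD IH1 IH2 -big_split; apply: eq_bigr => i _.
  by rewrite pihomogD mulrDl.
- rewrite -scalerAl linearZ /= IH scaler_sumr; apply: eq_bigr => i _.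
  by rewrite linearZ /= -scalerAl.
- elim/mpoly_mono_ind: q => [|b|c q IH|q1 q2 IH1 IH2]; first last.
  + rewrite mulrDr pihomogD IH1 IH2 -big_split; apply: eq_bigr => i _.
    by rewrite pihomogD mulrDr.
  + rewrite -scalerAr linearZ /= IH scaler_sumr; apply: eq_bigr => i _.
    by rewrite linearZ /= -scalerAr.
  + by apply: pihomogM_mon.
  + by rewrite mulr0 pihomog0 big1 // => i _; rewrite pihomog0 mulr0.
- by rewrite mul0r pihomog0 big1 // => i _; rewrite pihomog0 mul0r.
Qed.

Lemma pihomog0E n (mf : measure n) (p : {mpoly k[n]}) :
  (forall i, (0 < mf U_(i)%MM)%N) -> pihomog mf 0 p = (p@_0%MM)%:MP.
Proof.
move=> pos; have mf_eq0 a : (mf a == 0%N) = (a == 0%MM).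
  apply/eqP/eqP => [|->]; last by rewrite mf0.
  rewrite mfE => /eqP; rewrite sum_nat_eq0 => /forallP h.
  apply/mnmP => i; rewrite mnm0E; apply/eqP.
  by have := h i; rewrite muln_eq0 => /orP[//|/eqP e]; have := pos i; rewrite e.
elim/mpoly_mono_ind: p => [|mn|c p IH|p q IHp IHq].
- by rewrite pihomog0 mcoeff0 mpolyC0.
- by rewrite pihomogX mcoeffX mf_eq0; case: eqP => [->|_]; rewrite ?mpolyX0 ?mpolyC1 ?mpolyC0.
- by rewrite linearZ /= IH mcoeffZ mpolyCM mul_mpolyC.
- by rewrite pihomogD IHp IHq mcoeffD mpolyCD.
Qed.

Lemma mpoly_pihomog_sum n (mf : measure n) (p : {mpoly k[n]}) :
  exists N, p = \sum_(d < N) pihomog mf d p.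
Proof. by exists (mmeasure mf p); apply: pihomog_partitionE. Qed.

End Substitution.

Section Subalgebras.
Variables (k : fieldType) (n : nat).
Implicit Types (B : {mpoly k[n]} -> Prop) (mf : measure n).

Definition subalg B : Prop :=
  [/\ forall c, B c%:MP, forall p q, B p -> B q -> B (p + q) &
      forall p q, B p -> B q -> B (p * q)].

Definition graded mf B : Prop := forall p e, B p -> B (pihomog mf e p).

Definition gen m (f : m.-tuple {mpoly k[n]}) (p : {mpoly k[n]}) : Prop :=
  exists q, p = q \mPo f.

Section Closure.
Variable B : {mpoly k[n]} -> Prop.
Hypothesis hB : subalg B.

Lemma subalgC c : B c%:MP. Proof. by case: hB. Qed.
Lemma subalgD p q : B p -> B q -> B (p + q). Proof. by case: hB => _ h _; apply: h. Qed.
Lemma subalgM p q : B p -> B q -> B (p * q). Proof. by case: hB => _ _ h; apply: h. Qed.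
Lemma subalg0 : B 0. Proof. by rewrite -mpolyC0; apply: subalgC. Qed.
Lemma subalg1 : B 1. Proof. by rewrite -mpolyC1; apply: subalgC. Qed.
Lemma subalgZ c p : B p -> B (c *: p).
Proof. by rewrite -mul_mpolyC; apply: subalgM; apply: subalgC. Qed.
Lemma subalgN p : B p -> B (- p).
Proof. by rewrite -scaleN1r; apply: subalgZ. Qed.
Lemma subalgB p q : B p -> B q -> B (p - q).
Proof. by move=> Bp /subalgN; apply: subalgD. Qed.
Lemma subalg_sum I (r : seq I) (P : pred I) F :
  (forall i, P i -> B (F i)) -> B (\sum_(i <- r | P i) F i).
Proof. by move=> h; apply: big_ind => //; [apply: subalg0 | apply: subalgD]. Qed.
Lemma subalg_prod I (r : seq I) (P : pred I) F :
  (forall i, P i -> B (F i)) -> B (\prod_(i <- r | P i) F i).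
Proof. by move=> h; apply: big_ind => //; [apply: subalg1 | apply: subalgM]. Qed.

Lemma subalg_gen m (f : m.-tuple {mpoly k[n]}) p :
  (forall i, B (tnth f i)) -> gen f p -> B p.
Proof.
move=> hf [q ->]; elim/mpoly_induct: q => [c|i|p1 q IHp IHq|p1 q IHp IHq].
- by rewrite comp_mpolyC; apply: subalgC.
- by rewrite comp_mpolyX_tnth.
- by rewrite comp_mpolyD; apply: subalgD.
- by rewrite rmorphM /=; apply: subalgM.
Qed.
End Closure.

Lemma gen_subalg m (f : m.-tuple {mpoly k[n]}) : subalg (gen f).
Proof.
split=> [c|p q [p' ->] [q' ->]|p q [p' ->] [q' ->]].
- by exists c%:MP; rewrite comp_mpolyC.
- by exists (p' + q'); rewrite comp_mpolyD.
- by exists (p' * q'); rewrite rmorphM.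
Qed.

Lemma gen_tnth m (f : m.-tuple {mpoly k[n]}) i : gen f (tnth f i).
Proof. by exists 'X_i; rewrite comp_mpolyX_tnth. Qed.

Lemma gen_graded mf m (f : m.-tuple {mpoly k[n]}) (d : 'I_m -> nat) :
  (forall i, tnth f i \is (d i).-homog for mf) -> graded mf (gen f).
Proof.
move=> hf p e [q ->]; exists (pihomog (wgt d) e q).
by apply: pihomog_comp => i; rewrite /= wgtU.
Qed.

Lemma graded_generation mf B B' :
  (forall i, (0 < mf U_(i)%MM)%N) ->
  subalg B -> graded mf B -> subalg B' -> graded mf B' ->
  (forall p, pos_part B p -> exists q r,
     [/\ B' q, ideal_mul (pos_part B) (pos_part B) r & p = q + r]) ->
  forall p, B p -> B' p.
Proof.
move=> pos sB gB sB' gB' step.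
suff hom e p : B p -> p \is e.-homog for mf -> B' p.
  move=> p Bp; have [N ->] := mpoly_pihomog_sum mf p.
  apply: subalg_sum => // i _; apply: hom; [exact: gB | exact: pihomogP].
elim/ltn_ind: e p => e IH p Bp hp; rewrite -(pihomog_dE hp).
case: (posnP e) => [->|e0]; first by rewrite pihomog0E //; apply: subalgC.
have p0 : p@_0%MM = 0.
  by rewrite (dhomog_nemf_coeff hp) // mf0 neq_ltn e0.
have [q [r [B'q [s [hs ->]] ->]]] := step p (conj Bp p0).
rewrite pihomogD; apply: subalgD => //; first exact: gB'.
rewrite raddf_sum /= big_seq; apply: subalg_sum => // u us.
have [[Bu1 u10] [Bu2 u20]] := hs u us.
rewrite pihomogM; apply: subalg_sum => // i _.
case: (posnP i) => [->|i0].
  by rewrite pihomog0E // u10 mpolyC0 mul0r; apply: subalg0.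
case: (ltngtP i e) => [lt|gt|->]; first 1 last.
- by have := ltn_ord i; rewrite ltnS leqNgt gt.
- by rewrite subnn (pihomog0E u.2) // u20 mpolyC0 mulr0; apply: subalg0.
apply: subalgM => //; [apply: (IH i) | apply: (IH (e - i)%N)] => //;
  by [exact: gB | exact: pihomogP | rewrite ltn_subrL i0 e0].
Qed.

End Subalgebras.

Section LinearSubst.
Variable k : fieldType.

Definition lin n r (M : 'M[k]_(n, r)) : r.-tuple {mpoly k[n]} :=
  [tuple \sum_(i < n) M i j *: 'X_i | j < r].

Lemma actE n (M : 'M[k]_n) p : act M p = p \mPo lin M.
Proof. by []. Qed.

HB.instance Definition _ n (M : 'M[k]_n) :=
  GRing.RMorphism.copy (act M) (comp_mpoly (lin M)).
HB.instance Definition _ n (M : 'M[k]_n) :=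
  GRing.Linear.copy (act M) (comp_mpoly (lin M)).

Definition linform n (u : 'cV[k]_n) : {mpoly k[n]} := \sum_(i < n) u i 0 *: 'X_i.

Lemma tnth_lin n r (M : 'M[k]_(n, r)) j : tnth (lin M) j = linform (col j M).
Proof. by rewrite tnth_mktuple; apply: eq_bigr => i _; rewrite mxE. Qed.

Lemma linform_comp n r (M : 'M[k]_(n, r)) u : linform u \mPo lin M = linform (M *m u).
Proof.
rewrite /linform raddf_sum /=.
under eq_bigr do rewrite comp_mpolyZ comp_mpolyX_tnth tnth_mktuple scaler_sumr.
rewrite exchange_big; apply: eq_bigr => i _ /=.
by rewrite mxE scaler_suml; apply: eq_bigr => j _; rewrite scalerA mulrC.
Qed.

Lemma act_linform n (M : 'M[k]_n) u : act M (linform u) = linform (M *m u).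
Proof. exact: linform_comp. Qed.

Lemma lin_comp n r l (M : 'M[k]_(n, r)) (N : 'M[k]_(r, l)) p :
  (p \mPo lin N) \mPo lin M = p \mPo lin (M *m N).
Proof.
rewrite comp_mpolyA; congr (_ \mPo _); apply: eq_from_tnth => j.
rewrite tnth_mktuple !tnth_lin linform_comp; congr linform; apply/colP => a.
by rewrite !mxE; apply: eq_bigr => b _; rewrite mxE.
Qed.

Lemma linform_delta n (i : 'I_n) : linform (delta_mx i 0) = 'X_i.
Proof.
rewrite /linform (bigD1 i) //= mxE !eqxx scale1r big1 ?addr0 // => j ne.
by rewrite mxE (negPf ne) scale0r.
Qed.

Lemma lin1_comp n p : p \mPo lin (1%:M : 'M[k]_n) = p.
Proof.
rewrite -[RHS]comp_mpoly_id; congr (_ \mPo _); apply: eq_from_tnth => j.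
rewrite tnth_lin tnth_mktuple -linform_delta; congr linform.
by apply/matrixP => a b; rewrite !mxE ord1 eqxx andbT.
Qed.

Lemma act_mul n (M N : 'M[k]_n) p : act M (act N p) = act (M *m N) p.
Proof. exact: lin_comp. Qed.

Lemma act1 n p : act (1%:M : 'M[k]_n) p = p.
Proof. exact: lin1_comp. Qed.

Lemma mcoeff_linform n (u : 'cV[k]_n) i : (linform u)@_U_(i)%MM = u i 0.
Proof.
rewrite /linform raddf_sum /= (bigD1 i) //= big1 ?addr0 => [|j ne].
  by rewrite mcoeffZ mcoeffXU eqxx mulr1.
by rewrite mcoeffZ mcoeffXU (negPf ne) mulr0.
Qed.

Lemma linform_inj n : injective (@linform n).
Proof. by move=> u v e; apply/colP => i; rewrite -!mcoeff_linform e. Qed.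

Lemma linformB n (u v : 'cV[k]_n) : linform (u - v) = linform u - linform v.
Proof. by rewrite /linform -sumrB; apply: eq_bigr => i _; rewrite !mxE scalerBl. Qed.

Lemma linform_eq0 n (u : 'cV[k]_n) : (linform u == 0) = (u == 0).
Proof.
apply/eqP/eqP => [e|->]; last by rewrite /linform big1 // => i _; rewrite mxE scale0r.
by apply/colP => i; rewrite -mcoeff_linform e mcoeff0 mxE.
Qed.

Lemma linform_homog n (mf : measure n) (u : 'cV[k]_n) e :
  (forall i, u i 0 != 0 -> mf U_(i)%MM = e) -> linform u \is e.-homog for mf.
Proof.
move=> h; apply: rpred_sum => i _; have [->|ne] := eqVneq (u i 0) 0.
  by rewrite scale0r rpred0.
by apply: rpredZ; rewrite dhomogX h.
Qed.

Lemma linform_homog1 n (u : 'cV[k]_n) : linform u \is 1.-homog.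
Proof. by apply: linform_homog => i _; rewrite /= mdeg1. Qed.

Definition respects n (mf : measure n) (M : 'M[k]_n) : Prop :=
  forall i j, M i j != 0 -> mf U_(i)%MM = mf U_(j)%MM.

Lemma respects_mdeg n (M : 'M[k]_n) : respects mdeg M.
Proof. by move=> i j _ /=; rewrite !mdeg1. Qed.

Lemma pihomog_act n (mf : measure n) (M : 'M[k]_n) p e : respects mf M ->
  pihomog mf e (act M p) = act M (pihomog mf e p).
Proof.
move=> h; apply: pihomog_comp => j; rewrite tnth_lin; apply: linform_homog => i.
by rewrite mxE => /h.
Qed.

Lemma mcoeff0_act n (M : 'M[k]_n) p : (act M p)@_0%MM = p@_0%MM.
Proof.
apply: mcoeff0_comp => i; rewrite tnth_lin.
by apply: (dhomog_nemf_coeff (linform_homog1 _)); rewrite /= mdeg0.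
Qed.

End LinearSubst.

Opaque act.

Section Generic.

Lemma nonroot (R : idomainType) (P : {poly R}) :
  [pchar R] =i pred0 -> P != 0 -> exists t : nat, P.[t%:R] != 0.
Proof.
move=> ch P0; pose s := [seq i%:R : R | i <- iota 0 (size P)].
have us : uniq s.
  rewrite map_inj_in_uniq ?iota_uniq // => i j _ _.
  wlog le : i j / (i <= j)%N => [hw|].
    by case/orP: (leq_total i j) => le e; [apply: hw | apply/esym/hw].
  move/esym/eqP; rewrite -subr_eq0 -natrB // (proj1 (pcharf0P R)) // => e.
  by apply/eqP; rewrite eqn_leq le -subn_eq0.
case: (boolP (all (root P) s)) => [al|/allPn[x /mapP[i _ ->] h]].
  by have := max_poly_roots P0 al us; rewrite size_map size_iota ltnn.
by exists i.
Qed.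

Variables (k : fieldType) (char0 : [pchar k] =i pred0).

Lemma generic_vector r n (s : seq 'M[k]_(r, n)) :
  {in s, forall M, M != 0} -> exists u : 'cV_n, {in s, forall M, M *m u != 0}.
Proof.
move=> hs; pose v (t : k) : 'cV[k]_n := \col_j t ^+ j.
suff [P P0 hP] : exists2 P : {poly k}, P != 0 &
    forall t, P.[t] != 0 -> {in s, forall M, M *m v t != 0}.
  by have [t ht] := nonroot char0 P0; exists (v t%:R); apply: hP.
elim: s hs => [|M s IH] hs; first by exists 1; rewrite ?oner_neq0.
have [|P P0 hP] := IH; first by move=> N Ns; apply: hs; rewrite inE Ns orbT.
have /matrix0Pn[i [j Mij]] := hs M (mem_head _ _).
pose Q := \poly_(l < n) (if insub l is Some l' then M i l' else 0).
have Q0 : Q != 0.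
  apply: contraNneq Mij => e; move: (congr1 (fun q : {poly k} => q`_j) e).
  by rewrite coef_poly ltn_ord valK coef0 => ->.
exists (Q * P) => [|t]; first by rewrite mulf_neq0.
rewrite hornerM mulf_eq0 negb_or => /andP[Qt Pt] N.
rewrite inE => /orP[/eqP->|]; last exact: hP.
apply: contraNneq Qt => e; apply/eqP; move/matrixP/(_ i 0): e.
rewrite !mxE => <-; rewrite horner_poly; apply: eq_bigr => l _.
by rewrite valK mxE.
Qed.

Lemma natr_neq0 m : (0 < m)%N -> m%:R != 0 :> k.
Proof. by rewrite (proj1 (pcharf0P k)) // -lt0n. Qed.

Lemma pchar_mpoly n : [pchar {mpoly k[n]}] =i pred0.
Proof.
apply/pcharf0P => m; rewrite -mpolyC_nat mpolyC_eq0.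
exact: (proj1 (pcharf0P k)).
Qed.

End Generic.

Lemma horner_prod_XsubC (R : comNzRingType) (I : finType) (P : pred I) (c : I -> R) x :
  (\prod_(i | P i) ('X - (c i)%:P)).[x] = \prod_(i | P i) (x - c i).
Proof. by rewrite horner_prod; apply: eq_bigr => i _; rewrite hornerXsubC. Qed.

Lemma map_prod_XsubC (R S : comNzRingType) (f : {rmorphism R -> S})
    (I : finType) (P : pred I) (c : I -> R) :
  map_poly f (\prod_(i | P i) ('X - (c i)%:P)) = \prod_(i | P i) ('X - (f (c i))%:P).
Proof.
rewrite rmorph_prod; apply: eq_bigr => i _.
by rewrite /= rmorphB /= map_polyX map_polyC.
Qed.

(** * Invariants of finite groups *)

Section Invariants.
Variables (k : fieldType) (char0 : [pchar k] =i pred0).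
Variables (gT : finGroupType) (G : {group gT}) (n : nat).
Variable rG : mx_representation k G n.
Implicit Types p q : {mpoly k[n]}.

Lemma act_repr x y p : x \in G -> y \in G ->
  act (rG x) (act (rG y) p) = act (rG (x * y)%g) p.
Proof. by move=> Gx Gy; rewrite act_mul repr_mxM. Qed.

Lemma act_repr1 p : act (rG 1%g) p = p.
Proof. by rewrite repr_mx1 act1. Qed.

Lemma cardG_neq0 : #|G|%:R != 0 :> k.
Proof. exact: (natr_neq0 char0 (cardG_gt0 G)). Qed.

Lemma actC m (M : 'M[k]_m) c : act M c%:MP = c%:MP.
Proof. exact: comp_mpolyC. Qed.

Lemma invariant_subalg (H : {set gT}) : subalg (invariant rG H).
Proof.
split=> [c x _|p q hp hq x Hx|p q hp hq x Hx]; first exact: actC.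
  by rewrite raddfD /= hp ?hq.
by rewrite rmorphM /= hp ?hq.
Qed.

Lemma invariant_graded mf (H : {set gT}) :
  {in H, forall x, respects mf (rG x)} -> graded mf (invariant rG H).
Proof. by move=> h p e Bp x Hx; rewrite -pihomog_act ?Bp //; apply: h. Qed.

Lemma invariant_gradedS (H : {set gT}) : graded mdeg (invariant rG H).
Proof. by apply: invariant_graded => x _; apply: respects_mdeg. Qed.

Lemma invariantS (H K : {set gT}) p :
  H \subset K -> invariant rG K p -> invariant rG H p.
Proof. by move=> sHK h x Hx; apply: h; apply: (subsetP sHK). Qed.

Definition reynolds p := (#|G|%:R)^-1 *: \sum_(x in G) act (rG x) p.

Lemma reynoldsD p q : reynolds (p + q) = reynolds p + reynolds q.
Proof.
rewrite -scalerDr -big_split; congr (_ *: _); apply: eq_bigr => x _.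
by rewrite raddfD.
Qed.

Lemma reynolds_is_linear : linear reynolds.
Proof.
move=> c p q; rewrite reynoldsD; congr (_ + _).
rewrite scalerA mulrC -scalerA scaler_sumr; congr (_ *: _).
by apply: eq_bigr => x _; rewrite linearZ.
Qed.

HB.instance Definition _ :=
  GRing.isLinear.Build k {mpoly k[n]} {mpoly k[n]} _ reynolds reynolds_is_linear.

Lemma reynolds_invariant p : invariant rG G (reynolds p).
Proof.
move=> x Gx; rewrite /reynolds linearZ /= (raddf_sum (act (rG x))); congr (_ *: _) => /=.
rewrite [RHS](reindex_inj (mulgI x)) /=; apply: eq_big => [y|y Gy].
  by rewrite groupMl.
by rewrite act_repr.
Qed.

Lemma reynolds_id p : invariant rG G p -> reynolds p = p.
Proof.
move=> hp; rewrite /reynolds (eq_bigr (fun=> p)) => [|x Gx]; last exact: hp.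
by rewrite sumr_const -scaler_nat scalerA mulVf ?scale1r // cardG_neq0.
Qed.

Lemma reynoldsM p q : invariant rG G p -> reynolds (p * q) = p * reynolds q.
Proof.
move=> hp; rewrite /reynolds -scalerAr mulr_sumr; congr (_ *: _).
by apply: eq_bigr => x Gx; rewrite rmorphM /= hp.
Qed.

Lemma reynolds_pihomog mf p e : {in G, forall x, respects mf (rG x)} ->
  pihomog mf e (reynolds p) = reynolds (pihomog mf e p).
Proof.
move=> h; rewrite /reynolds linearZ /= (raddf_sum (pihomog mf e)); congr (_ *: _).
by apply: eq_bigr => x Gx /=; rewrite pihomog_act //; apply: h.
Qed.

Lemma mcoeff0_reynolds p : (reynolds p)@_0%MM = p@_0%MM.
Proof.
rewrite /reynolds mcoeffZ (raddf_sum (mcoeff 0%MM)) /= (eq_bigr (fun=> p@_0%MM)) => [|x _]; last exact: mcoeff0_act.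
by rewrite sumr_const -[p@_0%MM *+ _]mulr_natl mulrA mulVf ?mul1r // cardG_neq0.
Qed.

Definition orbit_poly (H : {set gT}) (l : {mpoly k[n]}) : {poly {mpoly k[n]}} :=
  \prod_(h in H) ('X - (act (rG h) l)%:P).

Lemma map_orbit_poly (M : 'M[k]_n) H l :
  map_poly (act M) (orbit_poly H l) = \prod_(h in H) ('X - (act M (act (rG h) l))%:P).
Proof. exact: map_prod_XsubC. Qed.

Lemma orbit_poly_invariant (H : {group gT}) l i :
  H \subset G -> invariant rG H (orbit_poly H l)`_i.
Proof.
move=> sHG x Hx; have Gx := subsetP sHG x Hx; rewrite -coef_map /=.
congr (_`_i); congr polyseq; rewrite map_orbit_poly /orbit_poly [RHS](reindex_inj (mulgI x)) /=.
apply: eq_big => [y|y Hy]; first by rewrite groupMl.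
by rewrite act_repr ?(subsetP sHG).
Qed.

Lemma orbit_poly_root (H : {group gT}) l : (orbit_poly H l).[l] = 0.
Proof.
by rewrite horner_prod_XsubC (bigD1 1%g) //= act_repr1 subrr mul0r.
Qed.

Lemma fixed_invariants_mem (H : {group gT}) x :
  mx_faithful rG -> H \subset G -> x \in G ->
  (forall p, invariant rG H p -> act (rG x) p = p) -> x \in H.
Proof.
move=> ff sHG Gx fixx; apply: contraT => nHx.
pose s := [seq rG x - rG h | h <- enum H].
have [|u hu] := @generic_vector _ char0 _ _ s.
  move=> M /mapP[h]; rewrite mem_enum => Hh ->; rewrite subr_eq0.
  apply: contra nHx => /eqP e.
  by rewrite (mx_faithful_inj ff _ _ e) // (subsetP sHG).
have : map_poly (act (rG x)) (orbit_poly H (linform u)) = orbit_poly H (linform u).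
  apply/polyP => i; rewrite coef_map /= fixx //.
  exact: orbit_poly_invariant.
move/(congr1 (fun P : {poly _} => P.[act (rG x) (linform u)])).
rewrite horner_map orbit_poly_root raddf0 => /esym/eqP.
rewrite horner_prod_XsubC => /prodf_eq0[h Hh].
rewrite !act_linform subr_eq0 => /eqP/linform_inj/eqP.
rewrite -subr_eq0 -mulmxBl (negPf (hu (rG x - rG h) _)) //.
by apply/mapP; exists h; rewrite ?mem_enum.
Qed.

Lemma size_orbit_poly (H : {set gT}) l : size (orbit_poly H l) = #|H|.+1.
Proof.
rewrite /orbit_poly -big_enum /= -(big_map (fun h => act (rG h) l) xpredT
  (fun z => 'X - z%:P)).
by rewrite size_prod_XsubC size_map -cardE.
Qed.

Lemma monic_orbit_poly (H : {set gT}) l : orbit_poly H l \is monic.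
Proof. by apply: monic_prod => h _; apply: monicXsubC. Qed.

Lemma monomial_reduction j : exists e : 'I_#|G| -> {mpoly k[n]},
  (forall i, invariant rG G (e i)) /\
  'X_j ^+ #|G| = \sum_(i < #|G|) e i * 'X_j ^+ i.
Proof.
exists (fun i : 'I_#|G| => - (orbit_poly G 'X_j)`_i); split=> [i|].
  by apply/(subalgN (invariant_subalg G))/orbit_poly_invariant.
have := orbit_poly_root G 'X_j; rewrite horner_coef size_orbit_poly big_ord_recr /=.
have /monicP := monic_orbit_poly G 'X_j; rewrite /lead_coef size_orbit_poly /= => ->.
rewrite mul1r addrC => /eqP; rewrite addr_eq0 => /eqP->.
by rewrite -sumrN; apply: eq_bigr => i _; rewrite mulNr.
Qed.

End Invariants.

Lemma ex_minimal (P : nat -> Prop) :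
  (exists m, P m) -> exists m, P m /\ forall l, (l < m)%N -> ~ P l.
Proof.
case=> m; elim/ltn_ind: m => m IH Pm.
have [[l [lt Pl]]|no] := classic (exists l, (l < m)%N /\ P l); first exact: IH lt Pl.
by exists m; split=> // l lt Pl; apply: no; exists l.
Qed.

Section GenSeq.
Variables (k : fieldType) (n : nat).
Implicit Types (s t : seq {mpoly k[n]}).

Lemma gen_mem_seq s p : p \in s -> gen (in_tuple s) p.
Proof. by case/(tnthP (in_tuple s)) => i ->; apply: gen_tnth. Qed.

Lemma gen_seq s (B : {mpoly k[n]} -> Prop) p :
  subalg B -> {in s, forall q, B q} -> gen (in_tuple s) p -> B p.
Proof. by move=> sB h; apply: subalg_gen => // i; apply: h; apply: mem_tnth. Qed.

Lemma pihomogM_hom (mf : measure n) (p q : {mpoly k[n]}) d e :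
  q \is d.-homog for mf ->
  pihomog mf e (p * q) = if (d <= e)%N then pihomog mf (e - d)%N p * q else 0.
Proof.
move=> hq; rewrite mulrC pihomogM; case: leqP => [le|lt].
  rewrite (bigD1 (inord d)) //= inordK ?ltnS // pihomog_dE //.
  rewrite [X in _ + X]big1 ?addr0 1?mulrC // => i ne.
  rewrite (pihomog_ne0 _ hq) ?mul0r //.
  by apply: contra ne => /eqP->; rewrite inord_val.
rewrite big1 // => i _; rewrite (pihomog_ne0 _ hq) ?mul0r //.
by rewrite neq_ltn (leq_ltn_trans _ lt) ?orbT // -ltnS.
Qed.

End GenSeq.

Section FiniteGeneration.
Variables (k : fieldType) (char0 : [pchar k] =i pred0).
Variables (gT : finGroupType) (G : {group gT}) (n : nat).
Variable rG : mx_representation k G n.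

(* Since 'X_j ^+ #|G| lies in the span of the lower powers over the algebra of
   invariants, averages of monomials can be reduced to bounded exponents. *)
Lemma invariants_fin_gen : exists s, alg_generates (invariant rG G) s.
Proof.
have [e he] := fin_all_exists (monomial_reduction rG).
pose mon (a : {ffun 'I_n -> 'I_#|G|}) := [multinom a i : nat | i < n].
pose s := [seq e j i | j <- enum 'I_n, i <- enum 'I_#|G|] ++
  [seq reynolds rG 'X_[mon a] | a <- enum {ffun 'I_n -> 'I_#|G|}].
exists s; split=> [q|p hp].
  rewrite mem_cat => /orP[/allpairsP[[j i] [_ _ ->]]|/mapP[a _ ->]] /=.
    by have [h _] := he j; apply: h.
  exact: reynolds_invariant.
have sg := gen_subalg (in_tuple s).
suff red mn : gen (in_tuple s) (reynolds rG 'X_[mn]).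
  rewrite -(reynolds_id char0 hp).
  apply: (@mpoly_mono_ind _ _ (fun p => gen _ (reynolds rG p))) => {p hp} [|//|c p IH|p q].
  - by rewrite raddf0; apply: (subalg0 sg).
  - by rewrite linearZ /=; apply: (subalgZ sg).
  - by rewrite raddfD /=; apply: (subalgD sg).
have [N eN] := ubnP (mdeg mn); elim: N => // N IH in mn eN *.
have [/forallP small|] := boolP [forall j, (mn j < #|G|)%N].
  apply: gen_mem_seq; rewrite mem_cat; apply/orP; right.
  apply/mapP; exists [ffun j => Ordinal (small j)]; rewrite ?mem_enum //.
  by congr (reynolds _ 'X_[_]); apply/mnmP => j; rewrite mnmE ffunE.
rewrite negb_forall => /existsP[j]; rewrite -leqNgt => big.
pose r := (mn - U_(j) *+ #|G|)%MM.
have le : (U_(j) *+ #|G| <= mn)%MM.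
  apply/mnm_lepP => i; rewrite mulmnE mnm1E.
  by case: eqP => [<-|_]; rewrite ?mul1n ?mul0n.
have mnE : mn = (r + U_(j) *+ #|G|)%MM by rewrite submK.
have [inv red] := he j.
rewrite mnE mpolyXD -mpolyXn mulrC red mulr_suml raddf_sum.
apply: (subalg_sum sg) => i _.
rewrite -mulrA /= reynoldsM //; apply: (subalgM sg).
  apply: gen_mem_seq; rewrite mem_cat; apply/orP; left.
  by apply/allpairsP; exists (j, i); rewrite !mem_enum.
rewrite mpolyXn -mpolyXD; apply: IH.
rewrite -ltnS; apply: leq_trans eN; rewrite ltnS mnE !mdegD !mdegMn mdeg1 !mul1n.
by rewrite addnC ltn_add2l.
Qed.

Definition all_homog (s : seq {mpoly k[n]}) : Prop :=
  {in s, forall p, exists e, p \is e.-homog}.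

Lemma invariants_min_gens :
  exists s, min_alg_generates (invariant rG G) s /\ all_homog s.
Proof.
pose Q s := alg_generates (invariant rG G) s /\ all_homog s.
have [s0 [s0G s0g]] := invariants_fin_gen.
pose N := \max_(p <- s0) msize p.
pose s1 := [seq pihomog mdeg e p | p <- s0, e <- iota 0 N].
have Q1 : Q s1.
  split; last by move=> _ /allpairsP[u [_ _ ->]]; exists u.2; apply: pihomogP.
  split=> [_ /allpairsP[u [u1 _ ->]]|p /s0g].
    by apply: invariant_gradedS; apply: s0G.
  apply: (gen_seq (gen_subalg _)) => q qs.
  rewrite (@pihomog_partitionE _ _ mdeg N q); last by rewrite /N (big_rem q) //= leq_maxl.
  apply: (subalg_sum (gen_subalg _)) => i _.
  by apply: gen_mem_seq; apply/allpairsP; exists (q, i : nat); split; rewrite ?mem_iota /=.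
have [|m [[s [Qs sm]] mmin]] := @ex_minimal (fun m => exists s, Q s /\ size s = m).
  by exists (size s1), s1.
exists s; case: Qs => sg sh; split=> //; split=> // t ts tg.
apply/eqP; move: (size_subseq_leqif ts) => /leqifP; case: eqP => // _ lt.
case: (mmin (size t)); first by rewrite -sm.
by exists t; split=> //; split=> // p pt; apply: sh; apply: (mem_subseq ts).
Qed.

End FiniteGeneration.

(** * Chevalley's theorem *)

Section IdealMul.
Variables (k : fieldType) (n : nat).
Implicit Types (P Q : {mpoly k[n]} -> Prop).

Lemma ideal_mul0 P Q : ideal_mul P Q 0.
Proof. by exists [::]; split=> //; rewrite big_nil. Qed.

Lemma ideal_mulD P Q p q : ideal_mul P Q p -> ideal_mul P Q q -> ideal_mul P Q (p + q).
Proof.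
move=> [s [hs ->]] [t [ht ->]]; exists (s ++ t); split; last by rewrite big_cat.
by move=> u; rewrite mem_cat => /orP[/hs|/ht].
Qed.

Lemma ideal_mul_in P Q p q : P p -> Q q -> ideal_mul P Q (p * q).
Proof.
move=> Pp Qq; exists [:: (p, q)]; split; last by rewrite big_seq1.
by move=> u; rewrite inE => /eqP->.
Qed.

Lemma ideal_mul_sum P Q I (r : seq I) (C : pred I) F :
  (forall i, C i -> ideal_mul P Q (F i)) -> ideal_mul P Q (\sum_(i <- r | C i) F i).
Proof.
by move=> h; apply: big_ind => //; [apply: ideal_mul0 | apply: ideal_mulD].
Qed.

Lemma ideal_mulMl P Q a p :
  (forall q, P q -> P (a * q)) -> ideal_mul P Q p -> ideal_mul P Q (a * p).
Proof.
move=> h [s [hs ->]]; rewrite mulr_sumr big_seq; apply: ideal_mul_sum => u us.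
by rewrite mulrA; have [? ?] := hs u us; apply: ideal_mul_in; first exact: h.
Qed.

Lemma ideal_mulZ P Q c p :
  (forall q, P q -> P (c *: q)) -> ideal_mul P Q p -> ideal_mul P Q (c *: p).
Proof.
move=> h; rewrite -mul_mpolyC; apply: ideal_mulMl => q /h.
by rewrite -mul_mpolyC.
Qed.

End IdealMul.

Section DividedDifferences.
Variable k : fieldType.

Lemma divided_difference n (u : 'cV[k]_n) (v : 'rV[k]_n) p :
  exists q, act (1%:M + u *m v) p - p = linform u * q.
Proof.
elim/mpoly_induct: p => [c|i|p q [p' ep] [q' eq]|p q [p' ep] [q' eq]].
- by exists 0; rewrite actC subrr mulr0.
- exists (v 0 i)%:MP; rewrite -linform_delta act_linform -linformB mulmxDl mul1mx addrC addKr.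
  rewrite mulrC mul_mpolyC /linform scaler_sumr; apply: eq_bigr => j _.
  rewrite scalerA -mulmxA mxE big_ord1 mulrC; congr (_ * _ *: _).
  rewrite mxE (bigD1 i) //= mxE !eqxx mulr1 big1 ?addr0 // => l ne.
  by rewrite mxE (negPf ne) mulr0.
- by exists (p' + q'); rewrite raddfD /= mulrDr -ep -eq opprD addrACA.
- exists (p' * act (1%:M + u *m v) q + p * q').
  rewrite mulrDr mulrA -ep mulrCA -eq rmorphM /= mulrBl mulrBr addrA.
  by rewrite subrK.
Qed.

Lemma divided_difference_homog n (u : 'cV[k]_n) (v : 'rV[k]_n) p e :
  p \is e.+1.-homog ->
  exists2 q, q \is e.-homog & act (1%:M + u *m v) p - p = linform u * q.
Proof.
move=> hp; have [q eq] := divided_difference u v p.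
exists (pihomog mdeg e q); first exact: pihomogP.
have := congr1 (pihomog mdeg e.+1) eq.
rewrite [in RHS]mulrC (pihomogM_hom _ _ (linform_homog1 u)) /= subn1 /= mulrC => <-.
by rewrite pihomogB pihomog_act ?pihomog_dE //; apply: respects_mdeg.
Qed.

Lemma rank1_factor m n (A : 'M[k]_(m, n)) : \rank A = 1%N ->
  exists2 u : 'cV[k]_m, u != 0 & exists v : 'rV[k]_n, A = u *m v.
Proof.
move=> r1; have e := mulmx_base A.
move: (col_base A) (row_base A) e; rewrite r1 => u v e; exists u; last by exists v.
by apply: contra_eq_neq r1 => u0; rewrite -e u0 mul0mx mxrank0.
Qed.

Lemma reflection_rank n (M : 'M[k]_n) : reflection M = (\rank (M - 1%:M)%R == 1%N).
Proof.
rewrite /reflection mxrank_ker; have := rank_leq_row (M - 1%:M).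
move: (\rank (M - 1%:M)) => r le.
lia.
Qed.

Lemma reflectionP n (M : 'M[k]_n) : reflection M ->
  exists2 u : 'cV[k]_n, u != 0 & exists v : 'rV[k]_n, M = 1%:M + u *m v.
Proof.
rewrite reflection_rank => /eqP/rank1_factor[u u0 [v e]]; exists u => //; exists v.
by rewrite -e addrC subrK.
Qed.

End DividedDifferences.

Section MinimalGenerators.
Variables (k : fieldType) (char0 : [pchar k] =i pred0).
Variables (gT : finGroupType) (G : {group gT}) (n : nat).
Variable rG : mx_representation k G n.
Variable s : seq {mpoly k[n]}.
Hypothesis smin : min_alg_generates (invariant rG G) s.
Local Notation f := (tnth (in_tuple s)).

Lemma min_gens_notin (i : 'I_(size s)) :
  ~ (forall B, subalg B -> (forall j, j != i -> B (f j)) -> B (f i)).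
Proof.
move=> hi; have [[sG sgen] smn] := smin.
pose t := [seq f j | j <- enum 'I_(size s) & j != i].
have ts : subseq t s.
  have es : s = [seq f j | j <- enum 'I_(size s)].
    by rewrite map_tnth_enum.
  rewrite [X in subseq _ X]es; by apply: map_subseq; apply: filter_subseq.
have tf j : j != i -> gen (in_tuple t) (f j).
  by move=> ne; apply: gen_mem_seq; apply: map_f; rewrite mem_filter ne mem_enum.
have tg : alg_generates (invariant rG G) t.
  split=> [q qt|p /sgen]; first by apply: sG; apply: (mem_subseq ts).
  apply: (subalg_gen (gen_subalg _)) => j.
  have [->|] := eqVneq j i; last exact: tf.
  by apply: hi => //; apply: gen_subalg.
have := congr1 size (smn t ts tg).
rewrite size_map size_filter -[RHS](size_enum_ord (size s)) => /eqP.
by rewrite -all_count => /allP/(_ i); rewrite mem_enum eqxx => /(_ isT).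
Qed.

Variable d : 'I_(size s) -> nat.
Hypothesis fd : forall i, f i \is (d i).-homog.

Lemma min_gens_deg i : (0 < d i)%N.
Proof.
case: (posnP (d i)) => // d0; exfalso.
apply: (@min_gens_notin i) => B' sB' _.
have := fd i; rewrite d0 => /pihomog_dE <-; rewrite pihomog0E; first exact: subalgC.
by move=> j; rewrite /= mdeg1.
Qed.

Lemma min_gens_mcoeff0 i : (f i)@_0%MM = 0.
Proof.
by apply: (dhomog_nemf_coeff (fd i)); rewrite /= mdeg0 eq_sym -lt0n min_gens_deg.
Qed.

Lemma min_gens_ideal i (c : 'I_(size s) -> {mpoly k[n]}) :
  f i <> \sum_(j | j != i) c j * f j.
Proof.
move=> e; have [[sG sgen] _] := smin.
have fG j : invariant rG G (f j) by apply: sG; apply: mem_tnth.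
have {c e} [c cG e] : exists2 c : 'I_(size s) -> {mpoly k[n]},
    forall j, invariant rG G (c j) & f i = \sum_(j | j != i) c j * f j.
  exists (fun j => reynolds rG (c j)) => [j|]; first exact: reynolds_invariant.
  rewrite -(reynolds_id char0 (fG i)) e raddf_sum /=; apply: eq_bigr => j _.
  by rewrite mulrC reynoldsM // mulrC.
apply: (@min_gens_notin i) => B' sB' hB'.
have low p a : invariant rG G p -> (a < d i)%N -> B' (pihomog mdeg a p).
  move=> /sgen[q ->] lt.
  have -> : pihomog mdeg a (q \mPo in_tuple s) = pihomog (wgt d) a q \mPo in_tuple s.
    by apply: pihomog_comp => j; rewrite /= wgtU.
  rewrite pihomogE raddf_sum /=; apply: (subalg_sum sB') => mn /eqP wmn.
  rewrite comp_mpolyZ; apply: (subalgZ sB'); rewrite comp_mpolyX.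
  apply: (subalg_prod sB') => j _; have [ji|ji] := eqVneq j i.
    have -> : mn j = 0%N; last by rewrite expr0; apply: (subalg1 sB').
    apply/eqP; rewrite -leqn0 leqNgt; apply/negP => mj.
    move: lt; rewrite -wmn /= /wgt (bigD1 j) //= ji ltnNge.
    by rewrite (leq_trans _ (leq_addr _ _)) // leq_pmulr // -ji.
  elim: (mn j : nat) => [|a0 IH]; first by rewrite expr0; apply: (subalg1 sB').
  by rewrite exprS; apply: (subalgM sB') => //; apply: hB'.
rewrite -(pihomog_dE (fd i)) {1}e raddf_sum /=; apply: (subalg_sum sB') => j ji.
rewrite (pihomogM_hom _ _ (fd j)); case: leqP => le; last exact: (subalg0 sB').
apply: (subalgM sB'); last exact: hB'.
by apply: low => //; rewrite ltn_subrL min_gens_deg (leq_trans (min_gens_deg j)).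
Qed.

End MinimalGenerators.

Section Chevalley.
Variables (k : fieldType) (char0 : [pchar k] =i pred0).
Variables (gT : finGroupType) (G : {group gT}) (n : nat).
Variable rG : mx_representation k G n.
Hypothesis genG : G :=: <<[set s in G | reflection (rG s)]>>.

Definition hilbert_ideal : {mpoly k[n]} -> Prop :=
  ideal_mul (fun=> True) (pos_part (invariant rG G)).

Lemma hilbert_idealM a p : hilbert_ideal p -> hilbert_ideal (a * p).
Proof. exact: ideal_mulMl. Qed.

Lemma hilbert_idealN p : hilbert_ideal p -> hilbert_ideal (- p).
Proof. by rewrite -mulN1r; apply: hilbert_idealM. Qed.

Lemma hilbert_ideal_inv p : pos_part (invariant rG G) p -> hilbert_ideal p.
Proof. by move=> hp; rewrite -[p]mul1r; apply: ideal_mul_in. Qed.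

Lemma hilbert_ideal_act x p : x \in G -> hilbert_ideal p -> hilbert_ideal (act (rG x) p).
Proof.
move=> Gx [s [hs ->]]; rewrite raddf_sum big_seq /=; apply: ideal_mul_sum => u us.
have [_ [u2 u20]] := hs u us.
by rewrite rmorphM /= (u2 x Gx); apply: ideal_mul_in.
Qed.

Lemma hilbert_ideal_moved p :
  (forall x, x \in G -> reflection (rG x) -> hilbert_ideal (act (rG x) p - p)) ->
  forall x, x \in G -> hilbert_ideal (act (rG x) p - p).
Proof.
move=> h x Gx.
have /gen_prodgP[m [c hc ->]] : x \in <<[set s in G | reflection (rG s)]>> by rewrite -genG.
elim: m c hc => [|m IH] c hc.
  by rewrite big_ord0 act_repr1 subrr; apply: ideal_mul0.
rewrite big_ord_recl; set y := (\prod_(i < m) _)%g.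
have /IH hy : forall i : 'I_m, c (lift ord0 i) \in [set s in G | reflection (rG s)] by [].
have Gy : y \in G by apply: group_prod => i _; have := hc (lift ord0 i); rewrite inE => /andP[].
have := hc ord0; rewrite inE => /andP[Gc rc].
have -> : act (rG (c ord0 * y)%g) p - p =
    act (rG (c ord0)) (act (rG y) p - p) + (act (rG (c ord0)) p - p).
  by rewrite raddfB /= act_repr // addrA subrK.
by apply: ideal_mulD; [apply: hilbert_ideal_act | apply: h].
Qed.

(* Induction on the degree of [g i0]: applying a reflection and dividing by the
   equation of its hyperplane lowers the degree and preserves the relation. *)
Lemma relation_hilbert_homog (I : finType) (S : {set I}) (h : I -> {mpoly k[n]}) i0 :
  i0 \in S -> (forall i, invariant rG G (h i)) ->
  (forall c, (forall i, invariant rG G (c i)) ->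
    h i0 <> \sum_(i in S :\ i0) c i * h i) ->
  forall e g, g i0 \is e.-homog -> \sum_(i in S) g i * h i = 0 ->
  hilbert_ideal (g i0).
Proof.
move=> Si0 hG hn; elim=> [|e IH] g hg.
  rewrite (big_setD1 i0) //= => e0.
  have gc : g i0 = ((g i0)@_0%MM)%:MP.
    by rewrite -{1}(pihomog_dE hg) pihomog0E // => j; rewrite /= mdeg1.
  have [c0|c0] := eqVneq (g i0)@_0%MM 0.
    by rewrite gc c0 mpolyC0; apply: ideal_mul0.
  move: gc c0; move: (g i0)@_0%MM => b gc b0.
  case: (hn (fun i => reynolds rG (- b^-1 *: g i))) => [i|].
    exact: reynolds_invariant.
  rewrite (eq_bigr (fun i => reynolds rG (- b^-1 *: (g i * h i)))).
    rewrite -raddf_sum -scaler_sumr /=.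
    move/eqP: e0; rewrite addr_eq0 eq_sym eqr_oppLR => /eqP->.
    by rewrite scalerN scaleNr opprK gc mul_mpolyC scalerA mulVf // scale1r reynolds_id.
  by move=> i _; rewrite scalerAl [in RHS]mulrC reynoldsM // mulrC.
move=> rel.
have hs x : x \in G -> reflection (rG x) -> hilbert_ideal (act (rG x) (g i0) - g i0).
  move=> Gx /reflectionP[u u0 [v ex]]; rewrite ex.
  have [q hq eq] := divided_difference_homog u v hg.
  have [Q hQ] := fin_all_exists (fun i => divided_difference u v (g i)).
  pose g' i := if i == i0 then q else Q i.
  have eg' i : act (1%:M + u *m v) (g i) - g i = linform u * g' i.
    by rewrite /g'; case: eqP => [->|].
  rewrite eq; apply: hilbert_idealM; have -> : q = g' i0 by rewrite /g' eqxx.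
  apply: IH; first by rewrite /g' eqxx.
  have lu0 : linform u != 0 by rewrite linform_eq0.
  apply: (mulfI lu0); rewrite mulr0 mulr_sumr.
  have eh i : act (rG x) (g i) * h i = act (rG x) (g i * h i).
    by rewrite rmorphM /= (hG i x Gx).
  under eq_bigr do rewrite mulrA -eg' mulrBl -ex eh.
  by rewrite sumrB rel subr0 -raddf_sum rel raddf0.
have := hilbert_ideal_moved hs => moved.
have -> : g i0 = reynolds rG (g i0) - (reynolds rG (g i0) - g i0).
  by rewrite opprB addrC subrK.
apply: ideal_mulD.
  apply: hilbert_ideal_inv; split; first exact: reynolds_invariant.
  by rewrite mcoeff0_reynolds // (dhomog_nemf_coeff hg) //= mdeg0.
apply: hilbert_idealN.
have {2}-> : g i0 = (#|G|%:R)^-1 *: \sum_(x in G) g i0.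
  by rewrite sumr_const -scaler_nat scalerA mulVf ?scale1r // cardG_neq0.
rewrite -scalerBr -sumrB; apply: ideal_mulZ => //.
by apply: ideal_mul_sum => x Gx; apply: moved.
Qed.

Lemma relation_hilbert (I : finType) (S : {set I}) (h : I -> {mpoly k[n]}) a i0 :
  i0 \in S -> (forall i, invariant rG G (h i)) -> (forall i, h i \is (a i).-homog) ->
  (forall c, (forall i, invariant rG G (c i)) ->
    h i0 <> \sum_(i in S :\ i0) c i * h i) ->
  forall g, \sum_(i in S) g i * h i = 0 -> hilbert_ideal (g i0).
Proof.
move=> Si0 hG ha hn g rel; have [N ->] := mpoly_pihomog_sum mdeg (g i0).
apply: ideal_mul_sum => e _.
pose g' i := if (a i <= e + a i0)%N then pihomog mdeg (e + a i0 - a i)%N (g i) else 0.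
have -> : pihomog mdeg e (g i0) = g' i0 by rewrite /g' leq_addl addnK.
apply: (relation_hilbert_homog Si0 hG hn (e := e)).
  by rewrite /g' leq_addl addnK; apply: pihomogP.
transitivity (pihomog mdeg (e + a i0)%N (\sum_(i in S) g i * h i)).
  2: by rewrite rel pihomog0.
rewrite raddf_sum; apply: eq_bigr => i _ /=.
by rewrite (pihomogM_hom _ _ (ha i)) /g'; case: ifP => //; rewrite mul0r.
Qed.

Lemma euler_homog (p : {mpoly k[n]}) e : p \is e.-homog ->
  \sum_(j < n) 'X_j * p^`M(j) = e%:R *: p.
Proof.
move=> /dhomogP hp; rewrite [p]mpolyE scaler_sumr.
under eq_bigr do rewrite raddf_sum mulr_sumr.
rewrite exchange_big big_seq [RHS]big_seq /=; apply: eq_bigr => mn /hp /= <-.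
rewrite mdegE natr_sum scaler_suml; apply: eq_bigr => j _.
rewrite mderivZ mderivX !scalerA -scalerAr -mpolyXD addmC mulrC.
case: (posnP (mn j)) => [->|mj]; first by rewrite !mul0r !scale0r.
by rewrite submK // lep1mP -lt0n.
Qed.

Lemma whomog_mderiv m (d : 'I_m -> nat) (h : {mpoly k[m]}) i e :
  h \is e.-homog for (wgt d) -> h^`M(i) \is (e - d i).-homog for (wgt d).
Proof.
move=> /dhomogP hh; apply/dhomogP => mn; rewrite mcoeff_msupp mcoeff_mderiv => ne.
have : (mn + U_(i))%MM \in msupp h.
  by rewrite mcoeff_msupp; apply: contraNneq ne => ->; rewrite mul0rn.
by move/hh => /= <-; rewrite wgtD wgtU addnK.
Qed.

Lemma mderiv_eq0 m (h : {mpoly k[m]}) : (forall i, h^`M(i) = 0) -> h = (h@_0%MM)%:MP.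
Proof.
move=> dh; apply/mpolyP => mn; rewrite mcoeffC; have [->|ne] := eqVneq mn 0%MM.
  by rewrite mulr1.
rewrite mulr0; have [i mi] : exists i, mn i != 0%N.
  apply/existsP; apply: contraNT ne; rewrite negb_exists => /forallP z.
  by apply/eqP/mnmP => i; rewrite mnm0E; apply/eqP; have := z i; rewrite negbK.
have := mcoeff_mderiv i h (mn - U_(i))%MM.
rewrite dh mcoeff0 submK ?lep1mP // => /esym/eqP.
rewrite -mulr_natr mulf_eq0 => /orP[/eqP//|].
by rewrite (negPf (natr_neq0 char0 _)).
Qed.

Variable s : seq {mpoly k[n]}.
Hypothesis smin : min_alg_generates (invariant rG G) s.
Local Notation f := (tnth (in_tuple s)).
Variable d : 'I_(size s) -> nat.
Hypothesis fd : forall i, f i \is (d i).-homog.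

Lemma hilbert_ideal_gens p : hilbert_ideal p ->
  exists c : 'I_(size s) -> {mpoly k[n]}, p = \sum_i c i * f i.
Proof.
move=> [r [hr ->]]; pose Q p := exists c : 'I_(size s) -> {mpoly k[n]}, p = \sum_i c i * f i.
have Q0 : Q 0 by exists (fun=> 0); rewrite big1 // => i _; rewrite mul0r.
have QD p1 p2 : Q p1 -> Q p2 -> Q (p1 + p2).
  move=> [c1 ->] [c2 ->]; exists (fun i => c1 i + c2 i).
  by rewrite -big_split; apply: eq_bigr => i _; rewrite mulrDl.
have QM a p1 : Q p1 -> Q (a * p1).
  move=> [c ->]; exists (fun i => a * c i).
  by rewrite mulr_sumr; apply: eq_bigr => i _; rewrite mulrA.
have Qf i : Q (f i).
  exists (fun j => (j == i)%:R); rewrite (bigD1 i) //= eqxx mul1r big1 ?addr0 // => j.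
  by move/negPf->; rewrite mul0r.
rewrite big_seq; apply: (big_ind Q) => // u ur; have [_ [uG u0]] := hr u ur.
apply: (QM u.1 u.2); have [[_ sgen] _] := smin; have [q eq] := sgen _ uG.
suff [c e] : Q (u.2 - ((u.2)@_0%MM)%:MP) by exists c; rewrite -e u0 mpolyC0 subr0.
have -> : (u.2)@_0%MM = q@_0%MM.
  by rewrite eq mcoeff0_comp // => i; apply: (min_gens_mcoeff0 smin fd).
rewrite eq; apply: (@mpoly_induct _ _ (fun q => Q (q \mPo in_tuple s - (q@_0%MM)%:MP))) => {q eq} [c|i|p1 p2 h1 h2|p1 p2 h1 h2].
- by rewrite comp_mpolyC mcoeffC eqxx mulr1 subrr.
- by rewrite comp_mpolyX_tnth mcoeffX mnm1_eq0 mpolyC0 subr0; apply: Qf.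
- by rewrite comp_mpolyD mcoeffD mpolyCD opprD addrACA; apply: QD.
- rewrite !rmorphM /= -(subrK ((p1@_0%MM)%:MP * (p2 \mPo in_tuple s)) (_ * (_ \mPo _))).
  rewrite -mulrBl -addrA -mulrBr; apply: QD; last exact: (QM _ _ h2).
  by rewrite mulrC; apply: (QM _ _ h1).
Qed.

Theorem chevalley_independent (q : {mpoly k[size s]}) : q \mPo in_tuple s = 0 -> q = 0.
Proof.
have fG j : invariant rG G (f j) by case: smin => [[sG _] _]; apply: sG; apply: mem_tnth.
have comp0 e p : pihomog mdeg e (p \mPo in_tuple s) = pihomog (wgt d) e p \mPo in_tuple s.
  by apply: pihomog_comp => j; rewrite /= wgtU.
suff hom e p : p \is e.-homog for (wgt d) -> p \mPo in_tuple s = 0 -> p = 0.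
  move=> q0; have [N ->] := mpoly_pihomog_sum (wgt d) q.
  apply: big1 => i _; apply: (hom i); first exact: pihomogP.
  by rewrite -comp0 q0 pihomog0.
elim/ltn_ind: e p => e IH p hp p0; apply/eqP; apply: contraT => pn0.
pose h i := p^`M(i) \mPo in_tuple s.
have hG i : invariant rG G (h i).
  by apply: (subalg_gen (invariant_subalg _ _) fG); exists p^`M(i).
have hh i : h i \is (e - d i).-homog.
  by rewrite /h -(pihomog_dE (whomog_mderiv i hp)) -comp0; apply: pihomogP.
have [i1 hi1] : exists i, h i != 0.
  apply/existsP; apply: contraNT pn0; rewrite negb_exists => /forallP hz.
  have dz i : p^`M(i) = 0.
    have [//|ne] := eqVneq p^`M(i) 0.
    apply: (IH (e - d i)%N _ _ (whomog_mderiv i hp)); last first.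
      by have := hz i; rewrite negbK => /eqP.
    have [mn] : exists mn, mn \in msupp p^`M(i).
      by move: ne; rewrite -msupp_eq0; case: (msupp _) => // mn ? _; exists mn; apply: mem_head.
    rewrite mcoeff_msupp mcoeff_mderiv => ne'.
    have : (mn + U_(i))%MM \in msupp p.
      by rewrite mcoeff_msupp; apply: contraNneq ne' => ->; rewrite mul0rn.
    move/(dhomog_mf hp) => /= <-; rewrite wgtD wgtU addnK -addn1 leq_add2l.
    exact: (min_gens_deg smin fd).
  by move: p0; rewrite (mderiv_eq0 dz) comp_mpolyC => /eqP; rewrite mpolyC_eq0 => /eqP->.
pose spans (S : {set 'I_(size s)}) := forall j, exists c : 'I_(size s) -> {mpoly k[n]},
  (forall i, invariant rG G (c i)) /\ h j = \sum_(i in S) c i * h i.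
have [|m [[S [hS Sm]] Smin]] := @ex_minimal (fun m => exists S, spans S /\ #|S| = m).
  exists #|[set: 'I_(size s)]|, setT; split=> // j; exists (fun i => (i == j)%:R%:MP).
  split=> [i|]; first exact: (subalgC (invariant_subalg _ _)).
  rewrite (bigD1 j) ?inE //= eqxx mpolyC1 mul1r big1 ?addr0 // => i /andP[_ /negPf->].
  by rewrite mpolyC0 mul0r.
have [i0 Si0] : exists i, i \in S.
  apply/set0Pn; apply: contraNneq hi1 => S0; have [c [_ ->]] := hS i1.
  by rewrite S0 big_set0.
have hn c : (forall i, invariant rG G (c i)) -> h i0 <> \sum_(i in S :\ i0) c i * h i.
  move=> cG e0; case: (Smin #|S :\ i0|); first by rewrite -Sm (cardsD1 i0 S) Si0.
  exists (S :\ i0); split=> // j; have [b [bG ej]] := hS j.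
  exists (fun i => b i0 * c i + b i); split=> [i|].
    by have sI := invariant_subalg rG G; apply: (subalgD sI) => //; apply: (subalgM sI).
  rewrite ej (big_setD1 i0) //= e0 mulr_sumr -big_split; apply: eq_bigr => i _ /=.
  by rewrite mulrDl mulrA.
have [c hc] := fin_all_exists hS.
pose g l i := (f i)^`M(l) + \sum_(j | j \notin S) c j i * (f j)^`M(l).
have gI l : hilbert_ideal (g l i0).
  apply: (relation_hilbert Si0 hG hh hn).
  have := mderiv_comp (in_tuple s) p l; rewrite p0 mderiv0 => dz; rewrite [RHS]dz.
  rewrite [RHS](bigID (mem S)) /= [LHS](eq_bigr (fun i => h i * (f i)^`M(l) +
      \sum_(j | j \notin S) c j i * (f j)^`M(l) * h i)); last first.
    by move=> i _; rewrite mulrDl mulrC mulr_suml.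
  rewrite big_split; congr (_ + _); rewrite exchange_big; apply: eq_bigr => j _ /=.
  rewrite -/(h j) {1}(proj2 (hc j)) mulr_suml; apply: eq_bigr => i _.
  by rewrite mulrAC.
have [r hr] := fin_all_exists (fun l => hilbert_ideal_gens (gI l)).
have eul : \sum_(l < n) 'X_l * g l i0 =
    (d i0)%:R *: f i0 + \sum_(j | j \notin S) c j i0 * ((d j)%:R *: f j).
  rewrite -(euler_homog (fd i0)).
  under [X in _ = _ + X]eq_bigr do rewrite -(euler_homog (fd _)) mulr_sumr.
  rewrite exchange_big -big_split; apply: eq_bigr => l _ /=.
  rewrite mulrDr mulr_sumr; congr (_ + _).
  by apply: eq_bigr => j _; rewrite mulrCA.
pose x j := \sum_(l < n) 'X_l * r l j.
have eul2 : \sum_(l < n) 'X_l * g l i0 = \sum_j x j * f j.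
  under eq_bigr do rewrite hr mulr_sumr.
  rewrite exchange_big; apply: eq_bigr => j _ /=; rewrite mulr_suml.
  by apply: eq_bigr => l _; rewrite mulrA.
have x0 : pihomog mdeg 0 (x i0) = 0.
  rewrite pihomog0E => [|j]; last by rewrite /= mdeg1.
  rewrite raddf_sum big1 ?mpolyC0 // => l _ /=.
  by rewrite rmorphM /= mcoeffX mnm1_eq0 mul0r.
pose y j := (d i0)%:R^-1 *: (if (d j <= d i0)%N then
   pihomog mdeg (d i0 - d j) (x j - (if j \in S then 0 else (d j)%:R *: c j i0)) else 0).
apply: (False_ind (is_true false) (@min_gens_ideal _ char0 _ _ _ _ _ smin _ fd i0 y _)).
apply: (scalerI (natr_neq0 char0 (min_gens_deg smin fd i0))).
have e1 : (d i0)%:R *: f i0 =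
   \sum_j (x j - (if j \in S then 0 else (d j)%:R *: c j i0)) * f j.
  under eq_bigr do rewrite mulrBl.
  rewrite sumrB -eul2 eul [X in _ - X](bigID (mem S)) /= [X in _ - (X + _)]big1 => [|j Sj].
    rewrite add0r -[LHS]addr0 -addrA; congr (_ + _).
    rewrite -sumrB big1 // => j /negPf->.
    by rewrite -scalerAr -scalerAl subrr.
  by rewrite Sj mul0r.
rewrite -(pihomog_dE (fd i0)) -[LHS]linearZ /= e1 raddf_sum scaler_sumr /=.
rewrite (bigD1 i0) //= (pihomogM_hom _ _ (fd i0)) leqnn subnn pihomogB x0 Si0 pihomog0.
rewrite subr0 mul0r add0r; apply: eq_bigr => j _.
rewrite (pihomogM_hom _ _ (fd j)) /y -scalerAl scalerA mulfV; last first.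
  exact: (natr_neq0 char0 (min_gens_deg smin fd i0)).
by rewrite scale1r; case: ifP; rewrite ?mul0r.
Qed.

End Chevalley.

(** * Jacobians of systems of generators *)

Section Counting.
Variable k : fieldType.

Definition deg_le n e (p : {mpoly k[n]}) : Prop := {in msupp p, forall mn : 'X_{1..n}, (mdeg mn <= e)%N}.

Lemma deg_leM n e1 e2 (p q : {mpoly k[n]}) :
  deg_le e1 p -> deg_le e2 q -> deg_le (e1 + e2) (p * q).
Proof.
move=> h1 h2 mn /msuppM_le /allpairsP[[a b] [/= /h1 ha /h2 hb ->]].
by rewrite mdegD leq_add.
Qed.

Lemma deg_le1 n : deg_le 0 (1 : {mpoly k[n]}).
Proof. by move=> mn; rewrite msupp1 inE => /eqP->; rewrite mdeg0. Qed.

Lemma independent_size n r (f : r.-tuple {mpoly k[n]}) :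
  (forall q : {mpoly k[r]}, q \mPo f = 0 -> q = 0) -> (r <= n)%N.
Proof.
move=> ind; pose D := (\max_i msize (tnth f i)).+1.
have fD i : deg_le D (tnth f i).
  move=> mn /msize_mdeg_lt /ltnW /leq_trans-> //; rewrite /D leqW //.
  exact: (leq_bigmax i).
have cnt N : (N ^ r <= (r * (N * D)).+1 ^ n)%N.
  set M := (_ * _).+1.
  pose T1 := {ffun 'I_r -> 'I_N}; pose T2 := {ffun 'I_n -> 'I_M}.
  pose mon l L (a : {ffun 'I_l -> 'I_L}) := [multinom a i : nat | i < l].
  pose A := \matrix_(a < #|T1|, b < #|T2|)
    (('X_[mon _ _ (enum_val a)] \mPo f)@_(mon _ _ (enum_val b)) : k).
  suff : row_free A.
    move=> /eqP rA; have := rank_leq_col A.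
    by rewrite rA !card_ffun !card_ord.
  apply: inj_row_free => v vA.
  have z : (\sum_a v 0 a *: 'X_[mon _ _ (enum_val a)]) \mPo f = 0.
    apply/mpolyP => b; rewrite mcoeff0 (raddf_sum (comp_mpoly f)) (raddf_sum (mcoeff b)) /=.
    have [/forallP sb|] := boolP [forall i, (b i < M)%N].
      have /matrixP/(_ 0 (enum_rank [ffun i => Ordinal (sb i)] : 'I_#|T2|)) := vA.
      rewrite !mxE => e0; rewrite -[RHS]e0; apply: eq_bigr => a _.
      rewrite mxE enum_rankK comp_mpolyZ mcoeffZ; congr (_ * _@__).
      by apply/mnmP => i; rewrite mnmE ffunE.
    rewrite negb_forall => /existsP[i]; rewrite -leqNgt => big.
    apply: big1 => a _; rewrite comp_mpolyZ mcoeffZ memN_msupp_eq0 ?mulr0 //.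
    apply/negP; have : deg_le (r * (N * D)) ('X_[mon _ _ (enum_val a)] \mPo f).
      rewrite comp_mpolyX -{1}[r]card_ord -sum1_card big_distrl /=.
      apply: (big_ind2 (fun q e => deg_le e q)) => [|p1 e1 p2 e2|j _].
      - exact: deg_le1.
      - exact: deg_leM.
      rewrite mul1n => mn hmn; have /leq_trans -> // : (mdeg mn <= (mon _ _ (enum_val a)) j * D)%N.
        elim: (mon _ _ (enum_val a) j : nat) mn hmn => [|e IH] mn; first by rewrite expr0 => /deg_le1.
        by rewrite exprS mulSn; apply: deg_leM => //; apply: fD.
      by rewrite mnmE leq_mul2r ltnW ?orbT.
    move=> h /h; rewrite leqNgt => /negP; apply; apply: (leq_trans big).
    by rewrite mdegE (bigD1 i) //= leq_addr.
  have := ind _ z; move/mpolyP => za; apply/rowP => a.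
  have := za (mon _ _ (enum_val a)); rewrite mcoeff0 raddf_sum (bigD1 a) //= big1 => [|b ne].
    by rewrite addr0 mcoeffZ mcoeffX eqxx mulr1 mxE.
  rewrite mcoeffZ mcoeffX; case: eqP => [e|_]; last by rewrite mulr0.
  case/negP: ne; apply/eqP/enum_val_inj/ffunP => i; apply/val_inj.
  by move/mnmP/(_ i): e; rewrite !mnmE.
rewrite leqNgt; apply/negP => lt; pose E := (r * D).+1; pose N := (E ^ n).+1.
have := cnt N; apply/negP; rewrite -ltnNge.
have le1 : ((r * (N * D)).+1 <= E * N)%N by rewrite /E; nia.
apply: (leq_ltn_trans (n := (E * N) ^ n)); first by case: (n) => // n'; rewrite leq_exp2r.
apply: (leq_trans (n := N ^ n.+1)); last by rewrite leq_pexp2l.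
by rewrite expnMn expnS ltn_mul2r expn_gt0 /= ltnS leqnn.
Qed.

End Counting.

Section Jets.
Variables (k : fieldType) (char0 : [pchar k] =i pred0).
Variables (gT : finGroupType) (W : {group gT}) (n : nat).
Variable rW : mx_representation k W n.
Local Notation A := {mpoly k[n]}.

Definition jacobian r (f : r.-tuple A) : 'M[A]_(r, n) := \matrix_(i, j) (tnth f i)^`M(j).

(* A list of pairs [(p, r)] stands for the tensor sum of p (x) r in A (x) A, a
   function of two points x and y; [tval0 x T] is its restriction to the graph
   of the action of [x], and [tval1 x j T] that of its j-th derivative in the
   first variable. *)
Definition tval0 x (T : seq (A * A)) : A := \sum_(t <- T) t.2 * act (rW x) t.1.
Definition tval1 x j (T : seq (A * A)) : A := \sum_(t <- T) t.2 * (act (rW x) t.1)^`M(j).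
Definition tmul (a b : A) (T : seq (A * A)) :=
  [seq (a * t.1, t.2) | t <- T] ++ [seq (t.1, - (b * t.2)) | t <- T].

Lemma tval0_mul x a b T : tval0 x (tmul a b T) = (act (rW x) a - b) * tval0 x T.
Proof.
rewrite /tval0 /tmul big_cat !big_map mulrBl !mulr_sumr -sumrN; congr (_ + _).
  by apply: eq_bigr => t _; rewrite rmorphM /= mulrCA.
by apply: eq_bigr => t _; rewrite /= mulNr mulrA.
Qed.

Lemma tval1_mul x j a b T : tval1 x j (tmul a b T) =
  (act (rW x) a - b) * tval1 x j T + (act (rW x) a)^`M(j) * tval0 x T.
Proof.
rewrite /tval1 /tval0 /tmul big_cat !big_map mulrBl !mulr_sumr addrAC -sumrN.
congr (_ + _); last by apply: eq_bigr => t _; rewrite /= mulNr mulrA.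
rewrite -big_split; apply: eq_bigr => t _.
by rewrite rmorphM /= mderivM mulrDr addrC; congr (_ + _); rewrite mulrCA.
Qed.

Variables (H : {group gT}) (sHW : H \subset W).

Lemma tensor_separation a : invariant rW H a ->
  exists T, (forall x, x \in W :\: H -> tval0 x T = 0 /\ forall j, tval1 x j T = 0) /\
    forall x, x \in H -> tval0 x T = \prod_(u in W :\: H) (a - act (rW u) a) ^+ 2.
Proof.
move=> aH; rewrite -big_enum /=.
suff [T [T0 T1]] : exists T,
    (forall x, x \in enum (W :\: H) -> tval0 x T = 0 /\ forall j, tval1 x j T = 0) /\
    forall x, x \in H -> tval0 x T = \prod_(u <- enum (W :\: H)) (a - act (rW u) a) ^+ 2.
  by exists T; split=> // x xW; apply: T0; rewrite mem_enum.
elim: (enum _) => [|u us [T [T0 T1]]].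
  exists [:: (1, 1)]; split=> // x Hx.
  rewrite /tval0 big_seq1 big_nil mul1r; exact: (rmorph1 (act (rW x))).
exists (tmul a (act (rW u) a) (tmul a (act (rW u) a) T)); split=> x.
  rewrite inE => /orP[/eqP->|/T0[z0 z1]].
    by split=> [|j]; rewrite ?tval1_mul !tval0_mul subrr !mul0r ?mulr0 ?addr0.
  by split=> [|j]; rewrite ?tval1_mul !tval0_mul ?tval1_mul z0 ?z1 !mulr0 ?addr0 ?mulr0.
move=> Hx; rewrite !tval0_mul T1 // big_cons (aH x Hx) mulrA -expr2.
by [].
Qed.

Lemma tval1_sum r (theta : r.-tuple A) T :
  (forall p, invariant rW W p -> gen theta p) ->
  exists c : 'I_r -> A, forall j,
    \sum_(x in W) tval1 x j T = \sum_i c i * (tnth theta i)^`M(j).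
Proof.
move=> hgen; elim: T => [|t T [c hc]].
  exists (fun=> 0) => j; rewrite !big1 // => [i _|x _]; first by rewrite mul0r.
  by rewrite /tval1 big_nil.
have [|q eq] := hgen (\sum_(x in W) act (rW x) t.1).
  have -> : \sum_(x in W) act (rW x) t.1 = #|W|%:R *: reynolds rW t.1.
    by rewrite scalerA mulfV ?scale1r // cardG_neq0.
  exact/(subalgZ (invariant_subalg _ _))/reynolds_invariant.
exists (fun i => t.2 * (q^`M(i) \mPo theta) + c i) => j.
under eq_bigr do rewrite /tval1 big_cons -/(tval1 _ _ _).
rewrite big_split /= hc -mulr_sumr -(raddf_sum (mderiv j)) /= eq mderiv_comp mulr_sumr -big_split.
by apply: eq_bigr => i _; rewrite mulrDl mulrA.
Qed.

(* The sum over W of (psi(x) - psi(y)) * prod_u (a(x) - a(u y)) ^ 2, a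
   W-invariant function of x, has at x = y the differential of psi up to the
   factor displayed below. *)
Lemma jets r (theta : r.-tuple A) a psi :
  (forall p, invariant rW W p -> gen theta p) ->
  invariant rW H a -> invariant rW H psi ->
  exists c : 'I_r -> A, forall j,
    \sum_i c i * (tnth theta i)^`M(j) =
    #|H|%:R *: (\prod_(u in W :\: H) (a - act (rW u) a) ^+ 2) * psi^`M(j).
Proof.
move=> hgen aH pH; have [T [T0 T1]] := tensor_separation aH.
have [c hc] := tval1_sum (tmul psi psi T) hgen.
exists c => j; rewrite -hc (big_setID H) /= (setIidPr sHW).
rewrite [X in _ + X]big1 ?addr0 => [|x /T0[z0 z1]]; last first.
  by rewrite tval1_mul z0 z1 !mulr0 addr0.
rewrite (eq_bigr (fun=> (\prod_(u in W :\: H) (a - act (rW u) a) ^+ 2) * psi^`M(j))).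
  by rewrite sumr_const -scaler_nat scalerAl.
by move=> x Hx; rewrite tval1_mul (pH x Hx) subrr mul0r add0r T1 // mulrC.
Qed.

Lemma jets_mx r l (theta : r.-tuple A) (psi : l.-tuple A) a :
  (forall p, invariant rW W p -> gen theta p) ->
  invariant rW H a -> (forall i, invariant rW H (tnth psi i)) ->
  exists C : 'M[A]_(l, r), C *m jacobian theta =
    (#|H|%:R *: (\prod_(u in W :\: H) (a - act (rW u) a) ^+ 2)) *: jacobian psi.
Proof.
move=> hgen aH pH.
have [c hc] := fin_all_exists (fun i => jets hgen aH (pH i)).
exists (\matrix_(i, j) c i j); apply/matrixP => i j; rewrite !mxE -hc.
by apply: eq_bigr => b _; rewrite !mxE.
Qed.

End Jets.

Lemma separate_products (R : idomainType) (I J : finType) (A : {pred I}) (B : {pred J})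
    (x : I -> R) (y : J -> I -> R) i0 :
  [pchar R] =i pred0 -> i0 \in A -> (forall j i, j \in B -> i \in A -> x i0 != y j i) ->
  exists t : nat, forall j, j \in B ->
    \prod_(i in A) (t%:R - x i) != \prod_(i in A) (t%:R - y j i).
Proof.
move=> ch Ai0 ne.
pose P j := \prod_(i in A) ('X - (x i)%:P) - \prod_(i in A) ('X - (y j i)%:P).
have P0 : \prod_(j in B) P j != 0.
  apply/prodf_neq0 => j Bj; apply: contra_neq (_ : (P j).[x i0] != 0) => [->|].
    by rewrite horner0.
  rewrite /P hornerD hornerN !horner_prod_XsubC (bigD1 i0) //= subrr mul0r sub0r oppr_eq0.
  by apply/prodf_neq0 => i Ai; rewrite subr_eq0 ne.
have [t] := nonroot ch P0; rewrite horner_prod => /prodf_neq0 ht.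
exists t => j /ht; rewrite /P hornerD hornerN !horner_prod_XsubC.
by rewrite subr_eq0.
Qed.

Section LinearFactors.
Variables (k : fieldType) (n : nat).
Implicit Types (u : 'cV[k]_n) (D E F : {mpoly k[n]}).

Definition linform_prod F : Prop :=
  exists2 us : seq 'cV[k]_n, {in us, forall u, u != 0} & F = \prod_(u <- us) linform u.

Lemma linform_prod1 : linform_prod 1.
Proof. by exists [::]; rewrite ?big_nil. Qed.

Lemma linform_prodM E F : linform_prod E -> linform_prod F -> linform_prod (E * F).
Proof.
move=> [us hu ->] [vs hv ->]; exists (us ++ vs); last by rewrite big_cat.
by move=> u; rewrite mem_cat => /orP[/hu|/hv].
Qed.

Lemma linform_prodX E m : linform_prod E -> linform_prod (E ^+ m).
Proof.
move=> hE; elim: m => [|m IH]; first exact: linform_prod1.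
by rewrite exprS; apply: linform_prodM.
Qed.

Lemma linform_prod_linform u : u != 0 -> linform_prod (linform u).
Proof. by move=> u0; exists [:: u]; rewrite ?big_seq1 // => v; rewrite inE => /eqP->. Qed.

(* For v *m u = -1, the matrix 1 + u *m v is a projection onto the hyperplane
   linform u = 0, so that act (1 + u *m v) p = 0 says that linform u divides p. *)
Lemma linform_prod_divisor D E F c : c != 0 -> linform_prod F -> D * E = c *: F ->
  (exists b, D = b%:MP) \/ exists u v, v *m u = - 1%:M /\ act (1%:M + u *m v) D = 0.
Proof.
move=> c0 [us hus ->]; elim: us hus D E => [|u us IH] hus D E.
  rewrite big_nil -mul_mpolyC mulr1 => e; left.
  have DE0 : D * E != 0 by rewrite e mpolyC_eq0.
  have [D0 E0] : D != 0 /\ E != 0 by apply/andP; rewrite -negb_or -mulf_eq0.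
  have := msizeM D0 E0; rewrite e msizeC c0 => h.
  exists D@_0%MM; apply: msize1_polyC.
  have : msize E != 0%N by rewrite msize_poly_eq0.
  by move: h; case: (msize E) => // l; rewrite addnS /= => -> _; apply: leq_addr.
have u0 : u != 0 by apply: hus; rewrite mem_head.
have [v vu] : exists v : 'rV[k]_n, v *m u = - 1%:M.
  have /cV0Pn[i ui] := u0; exists (- (u i 0)^-1 *: delta_mx 0 i).
  apply/matrixP => a b; rewrite !ord1 -scalemxAl mxE -rowE !mxE eqxx mulr1n.
  by rewrite mulNr mulVf.
have Qu : act (1%:M + u *m v) (linform u) = 0.
  by rewrite act_linform mulmxDl mul1mx -mulmxA vu mulmxN mulmx1 subrr /linform big1 // => j _; rewrite mxE scale0r.
rewrite big_cons => e.
have [D0|D0] := eqVneq (act (1%:M + u *m v) D) 0; first by right; exists u, v.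
have E0 : act (1%:M + u *m v) E = 0.
  apply: (mulfI D0); have := congr1 (act (1%:M + u *m v)) e.
  by rewrite linearZ !rmorphM /= Qu mul0r scaler0 mulr0.
have [q eq] := divided_difference u v E; rewrite E0 sub0r in eq.
apply: (IH _ D (- q)) => [w wus|]; first by apply: hus; rewrite inE wus orbT.
have lu0 : linform u != 0 by rewrite linform_eq0.
apply: (mulfI lu0); rewrite -scalerAr -e mulrCA mulrN -eq opprK.
by [].
Qed.

End LinearFactors.

Section Jacobian.
Variables (k : fieldType) (char0 : [pchar k] =i pred0).
Variables (gT : finGroupType) (W : {group gT}) (n : nat).
Variable rW : mx_representation k W n.
Hypothesis faithW : mx_faithful rW.
Local Notation A := {mpoly k[n]}.

Lemma jacobian_vars : jacobian [tuple 'X_i | i < n] = 1%:M :> 'M[A]_n.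
Proof. by apply/matrixP => i j; rewrite !mxE tnth_mktuple mderivXU. Qed.

Lemma jacobian_comp r l (f : l.-tuple A) (g : r.-tuple A) (Q : 'I_r -> {mpoly k[l]}) :
  (forall i, tnth g i = Q i \mPo f) ->
  jacobian g = (\matrix_(i, j) ((Q i)^`M(j) \mPo f)) *m jacobian f.
Proof.
move=> e; apply/matrixP => i j; rewrite !mxE e mderiv_comp.
by apply: eq_bigr => b _; rewrite !mxE.
Qed.

Lemma jacobian_left_inverse r (theta : r.-tuple A) :
  (forall p, invariant rW W p -> gen theta p) ->
  exists C : 'M[A]_(n, r), exists F : A,
    [/\ F != 0, linform_prod F & C *m jacobian theta = F%:M].
Proof.
move=> hgen; pose s := [seq 1%:M - rW u | u <- enum (W :\ 1%g)].
have [|l hl] := generic_vector char0 (s := s).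
  move=> M /mapP[u]; rewrite mem_enum !inE => /andP[u1 Wu] ->.
  rewrite subr_eq0 eq_sym; apply: contra u1 => /eqP e.
  by apply/eqP/(mx_faithful_inj faithW); rewrite ?repr_mx1.
have sub1 : 1%G \subset W by apply: sub1G.
have inv1 p : invariant rW 1%G p by move=> x /set1P->; rewrite act_repr1.
have [C eC] := jets_mx char0 sub1 (psi := [tuple 'X_i | i < n]) (a := linform l)
   hgen (inv1 _) (fun=> inv1 _).
exists C; eexists; split; last first.
- by rewrite eC jacobian_vars cards1 scale1r scalemx1.
- apply: big_ind => [||u]; [exact: linform_prod1 | exact: linform_prodM|].
  move=> hu; apply: linform_prodX; rewrite act_linform -linformB -{1}[l]mul1mx -mulmxBl.
  by apply/linform_prod_linform/hl/mapP; exists u; rewrite ?mem_enum.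
apply/prodf_neq0 => u hu; rewrite expf_neq0 // act_linform -linformB -{1}[l]mul1mx -mulmxBl linform_eq0.
by apply/hl/mapP; exists u; rewrite ?mem_enum.
Qed.

Lemma size_generators r (theta : r.-tuple A) :
  (forall p, invariant rW W p -> gen theta p) -> (n <= r)%N.
Proof.
move=> /jacobian_left_inverse[C [F [F0 _ e]]].
have := congr1 (map_mx (@tofrac A)) e; rewrite map_mxM map_scalar_mx => e'.
have : \rank ((tofrac F)%:M : 'M_n) = n.
  by rewrite -scalemx1 mxrank_scale_nz ?mxrank1 // tofrac_eq0.
by rewrite -e' => <-; apply: leq_trans (mxrankM_maxl _ _) (rank_leq_col _).
Qed.

Lemma jacobian_divides (theta : n.-tuple A) :
  (forall p, invariant rW W p -> gen theta p) ->
  exists c F, [/\ F != 0, linform_prod F & c * \det (jacobian theta) = F].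
Proof.
move=> /jacobian_left_inverse[C [F [F0 lF e]]].
exists (\det C), (F ^+ n); split; [exact: expf_neq0 | exact: linform_prodX|].
by rewrite -det_mulmx e det_scalar.
Qed.

Lemma jacobian_neq0 (theta : n.-tuple A) :
  (forall p, invariant rW W p -> gen theta p) -> \det (jacobian theta) != 0.
Proof.
case/jacobian_divides => c [F [F0 _ e]].
by apply: contraNneq F0 => z; rewrite -e z mulr0.
Qed.

Lemma linear_part (B : A -> Prop) l (f : l.-tuple A) (q : {mpoly k[l]}) :
  subalg B -> (forall i, pos_part B (tnth f i)) ->
  ideal_mul (pos_part B) (pos_part B)
    (q \mPo f - (q@_0%MM)%:MP - \sum_i (q^`M(i))@_0%MM *: tnth f i).
Proof.
move=> sB fB.
have posZ c p : pos_part B p -> pos_part B (c *: p).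
  by move=> [Bp p0]; split; [exact: (subalgZ sB)|rewrite mcoeffZ p0 mulr0].
have posC (p : {mpoly k[l]}) : pos_part B (p \mPo f - (p@_0%MM)%:MP).
  split; last first.
    rewrite mcoeffB mcoeff0_comp ?mcoeffC ?eqxx ?mulr1 ?subrr // => i.
    by case: (fB i).
  apply: (subalgB sB); last exact: (subalgC sB).
  by apply: (subalg_gen sB (f := f)) => [i|]; [case: (fB i) | exists p].
elim/mpoly_induct: q => [c|i|p q IHp IHq|p q IHp IHq].
- rewrite comp_mpolyC mcoeffC eqxx mulr1 subrr sub0r big1 => [|i _].
    by rewrite oppr0; apply: ideal_mul0.
  by rewrite mderivC mcoeff0 scale0r.
- rewrite comp_mpolyX_tnth mcoeffX mnm1_eq0 mpolyC0 subr0 (bigD1 i) //= big1.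
    by rewrite mderivXU eqxx mcoeff1 eqxx scale1r addr0 subrr; apply: ideal_mul0.
  by move=> j /negPf ne; rewrite mderivXU eq_sym ne mcoeff0 scale0r.
- rewrite comp_mpolyD mcoeffD mpolyCD.
  under eq_bigr do rewrite mderivD mcoeffD scalerDl.
  rewrite big_split /=; move: IHp IHq; set lp := \sum_i _; set lq := \sum_i _ => IHp IHq.
  rewrite (_ : _ - _ = (p \mPo f - (p@_0%MM)%:MP - lp) + (q \mPo f - (q@_0%MM)%:MP - lq)).
    exact: ideal_mulD.
  ring.
rewrite !rmorphM /=.
have -> : \sum_i ((p * q)^`M(i))@_0%MM *: tnth f i =
  q@_0%MM *: (\sum_i (p^`M(i))@_0%MM *: tnth f i) + p@_0%MM *: (\sum_i (q^`M(i))@_0%MM *: tnth f i).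
  rewrite !scaler_sumr -big_split; apply: eq_bigr => i _ /=.
  by rewrite mderivM mcoeffD !rmorphM /= scalerDl !scalerA mulrC.
move: IHp IHq; set lp := \sum_i _; set lq := \sum_i _.
move=> IHp IHq; set P := p \mPo f; set Q := q \mPo f.
have -> : P * Q - (p@_0%MM)%:MP * (q@_0%MM)%:MP - (q@_0%MM *: lp + p@_0%MM *: lq) =
  (P - (p@_0%MM)%:MP) * (Q - (q@_0%MM)%:MP) +
  (q@_0%MM *: (P - (p@_0%MM)%:MP - lp) + p@_0%MM *: (Q - (q@_0%MM)%:MP - lq)).
  by rewrite -!mul_mpolyC; ring.
apply: ideal_mulD; last by apply: ideal_mulD; apply: ideal_mulZ => //; apply: posZ.
by apply: ideal_mul_in; apply: posC.
Qed.

End Jacobian.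

(** * Groups with polynomial invariants are generated by reflections *)

Section SizeOfMinimalGenerators.
Variables (k : fieldType) (char0 : [pchar k] =i pred0).
Variables (gT : finGroupType) (G : {group gT}) (n : nat).
Variable rG : mx_representation k G n.
Hypothesis genG : G :=: <<[set s in G | reflection (rG s)]>>.

Lemma size_min_generators s :
  min_alg_generates (invariant rG G) s -> all_homog s -> (size s <= n)%N.
Proof.
move=> smin hs.
have [d hd] := fin_all_exists (fun i => hs _ (mem_tnth i (in_tuple s))).
apply: (independent_size (f := in_tuple s)).
exact: (chevalley_independent char0 genG smin hd).
Qed.

Lemma chevalley_generators : mx_faithful rG ->
  exists psi : n.-tuple {mpoly k[n]},
    [/\ forall i, pos_part (invariant rG G) (tnth psi i) &
        forall p, invariant rG G p -> gen psi p].
Proof.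
move=> ff; have [s [smin hs]] := invariants_min_gens char0 rG.
have le := size_min_generators smin hs; have [[sG sgen] _] := smin.
have ge := size_generators char0 ff (theta := in_tuple s) sgen.
have es : size s = n by apply/eqP; rewrite eqn_leq le ge.
have [d hd] := fin_all_exists (fun i => hs _ (mem_tnth i (in_tuple s))).
have pos i : pos_part (invariant rG G) (tnth (in_tuple s) i).
  by split; [apply: sG; apply: mem_tnth | apply: (min_gens_mcoeff0 smin hd)].
exists (tcast es (in_tuple s)).
move: (in_tuple s) pos sgen => t; move: (size s) es t => l el; subst l => t pos sgen.
by split=> [i|p /sgen//].
Qed.

End SizeOfMinimalGenerators.

Section Converse.
Variables (k : fieldType) (char0 : [pchar k] =i pred0).
Variables (gT : finGroupType) (W : {group gT}) (n : nat).
Variable rW : mx_representation k W n.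
Hypothesis faithW : mx_faithful rW.
Local Notation A := {mpoly k[n]}.
Local Notation H := <<[set s in W | reflection (rW s)]>>%G.

Let sHW : H \subset W.
Proof. by rewrite gen_subG; apply/subsetP => s; rewrite inE => /andP[]. Qed.

(* Modulo a linear form, the invariants of the reflection subgroup H separate
   the translates under W \ H: otherwise some u in W \ H and h in H would make
   rW (u * h) the identity on a hyperplane. *)
Lemma reflection_invariants_separate (u : 'cV[k]_n) (v : 'rV[k]_n) :
  exists2 a, invariant rW H a & forall y, y \in W :\: H ->
    act (1%:M + u *m v) a != act (1%:M + u *m v) (act (rW y) a).
Proof.
set Q := 1%:M + u *m v.
pose s := [seq Q - Q *m rW y | y <- enum (W :\: H)].
have [|l hl] := generic_vector char0 (s := s).
  move=> M /mapP[y]; rewrite mem_enum inE => /andP[nHy Wy] ->; rewrite subr_eq0.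
  apply: contra (nHy) => /eqP eQ; apply: mem_gen; rewrite inE Wy reflection_rank /=.
  have N1 : rW y - 1%:M = - u *m (v *m (rW y - 1%:M)).
    have : Q *m (rW y - 1%:M) = 0 by rewrite mulmxBr mulmx1 -eQ subrr.
    rewrite {1}/Q mulmxDl mul1mx mulNmx mulmxA => /eqP.
    by rewrite addr_eq0 => /eqP.
  rewrite eqn_leq lt0n mxrank_eq0; apply/andP; split.
    by rewrite N1; apply: leq_trans (mxrankM_maxr _ _) (rank_leq_row _).
  apply: contra nHy; rewrite subr_eq0 => /eqP y1.
  by rewrite (mx_faithful_inj faithW Wy (group1 W)) ?repr_mx1 // group1.
have ne y h : y \in W :\: H -> h \in H ->
    act Q (act (rW 1%g) (linform l)) != act (Q *m rW y) (act (rW h) (linform l)).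
  move=> hy Hh; have Wh := subsetP sHW h Hh; have := hy; rewrite inE => /andP[nHy Wy].
  rewrite -act_mul act_repr1 act_repr // !act_linform; apply/eqP => /linform_inj/eqP.
  rewrite mulmxA -subr_eq0 -mulmxBl (negPf (hl _ _)) //; apply/mapP.
  by exists (y * h)%g; rewrite ?mem_enum // inE groupMr // nHy groupM.
have [t ht] := separate_products (x := fun h => act Q (act (rW h) (linform l)))
  (y := fun y h => act (Q *m rW y) (act (rW h) (linform l)))
  (pchar_mpoly char0 n) (group1 H) ne.
have act_prod (M : 'M[k]_n) : act M (\prod_(h in H) (t%:R - act (rW h) (linform l))) =
    \prod_(h in H) (t%:R - act M (act (rW h) (linform l))).
  by rewrite rmorph_prod; apply: eq_bigr => h _; rewrite rmorphB rmorph_nat.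
exists (\prod_(h in H) (t%:R - act (rW h) (linform l))) => [x Hx|y hy]; last first.
  by rewrite act_mul !act_prod; apply: ht.
rewrite act_prod [RHS](reindex_inj (mulgI x)) /=.
apply: eq_big => [h|h Hh]; first by rewrite groupMl.
by rewrite act_repr ?(subsetP sHW).
Qed.

Lemma reflection_generated (theta : n.-tuple A) :
  (forall i, invariant rW W (tnth theta i)) ->
  (forall p, invariant rW W p -> gen theta p) ->
  W :=: <<[set s in W | reflection (rW s)]>>.
Proof.
move=> thetaW hgen; pose rH := subg_repr rW sHW.
have faithH : mx_faithful rH by apply: subg_mx_faithful.
have genH : H :=: <<[set s in H | reflection (rH s)]>>.
  apply/eqP; rewrite eqEsubset [X in _ && X]gen_subG; apply/andP; split.
    apply: genS; apply/subsetP => s sS; rewrite inE mem_gen //.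
    by move: sS; rewrite inE => /andP[].
  by apply/subsetP => s; rewrite inE => /andP[].
have [psi [psiH hpsi]] := chevalley_generators char0 genH faithH.
have [Theta hTheta] : exists Theta : 'I_n -> {mpoly k[n]},
    forall i, tnth theta i = Theta i \mPo psi.
  by have := fin_all_exists (fun i => hpsi _ (invariantS sHW (thetaW i))).
pose Dm := \matrix_(i, j) ((Theta i)^`M(j) \mPo psi); pose D := \det Dm.
have eJ : \det (jacobian theta) = D * \det (jacobian psi).
  by rewrite (jacobian_comp hTheta) det_mulmx.
have J0 : \det (jacobian psi) != 0 := jacobian_neq0 char0 faithH hpsi.
have [c [F [F0 lF eF]]] := jacobian_divides char0 faithW hgen.
have D0 : D != 0.
  apply: contraNneq (jacobian_neq0 char0 faithW hgen) => D0.
  by rewrite eJ D0 mul0r.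
have [[b Db]|[u [v [vu QD]]]] : (exists b : k, D = b%:MP) \/
    exists (u : 'cV[k]_n) (v : 'rV[k]_n), v *m u = - 1%:M /\ act (1%:M + u *m v) D = 0.
- apply: (@linform_prod_divisor _ _ D (c * \det (jacobian psi)) F 1) => //.
    exact: oner_neq0.
  by rewrite scale1r -eF eJ mulrCA.
- apply/eqP; rewrite eqEsubset sHW andbT; apply/subsetP => x Wx.
  apply: (fixed_invariants_mem char0 faithW sHW Wx) => p pH.
  suff : invariant rW W p by apply.
  have sH := invariant_subalg rH H; have sWi := invariant_subalg rW W.
  have mdeg_pos (i : 'I_n) : (0 < mdeg U_(i)%MM)%N by rewrite mdeg1.
  apply: (graded_generation (mf := mdeg) mdeg_pos sH (@invariant_gradedS _ _ _ _ rH H) sWi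
    (@invariant_gradedS _ _ _ _ rW W) _ (pH : invariant rH H p)).
  pose L : 'M[k]_n := \matrix_(i, j) ((Theta i)^`M(j))@_0%MM.
  have psi0 i : (tnth psi i)@_0%MM = 0 by case: (psiH i).
  have uL : L \in unitmx.
    rewrite unitmxE unitfE; have -> : L = map_mx (mcoeff 0%MM) Dm.
      by apply/matrixP => i j; rewrite !mxE mcoeff0_comp.
    rewrite det_map_mx -/D Db /= mcoeffC eqxx mulr1.
    by apply: contraNneq D0 => b0; rewrite Db b0 mpolyC0.
  have posZ a q : pos_part (invariant rH H) q -> pos_part (invariant rH H) (a *: q).
    by move=> [Bq q0]; split; [exact: (subalgZ sH)|rewrite mcoeffZ q0 mulr0].
  move=> {pH} _ [/hpsi[q ->] q0]; rewrite mcoeff0_comp // in q0.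
  pose e (r : {mpoly k[n]}) := r \mPo psi - (r@_0%MM)%:MP - \sum_i (r^`M(i))@_0%MM *: tnth psi i.
  have he r : ideal_mul (pos_part (invariant rH H)) (pos_part (invariant rH H)) (e r).
    exact: linear_part.
  pose g := \row_i (q^`M(i))@_0%MM *m invmx L.
  exists (\sum_a g 0 a *: (tnth theta a - ((Theta a)@_0%MM)%:MP)),
    (e q - \sum_a g 0 a *: e (Theta a)); split.
  + apply: (subalg_sum sWi) => a _; apply: (subalgZ sWi); apply: (subalgB sWi) => //.
    exact: (subalgC sWi).
  + apply: ideal_mulD => //; rewrite -sumrN; apply: ideal_mul_sum => a _.
    by rewrite -scaleNr; apply: ideal_mulZ => //; apply: posZ.
  have eS : \sum_i (q^`M(i))@_0%MM *: tnth psi i =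
      \sum_a g 0 a *: \sum_i ((Theta a)^`M(i))@_0%MM *: tnth psi i.
    under [RHS]eq_bigr do rewrite scaler_sumr.
    rewrite exchange_big; apply: eq_bigr => i _ /=.
    under eq_bigr do rewrite scalerA.
    rewrite -scaler_suml; congr (_ *: _).
    have /rowP/(_ i) : \row_i (q^`M(i))@_0%MM = g *m L by rewrite mulmxKV.
    by rewrite !mxE => ->; apply: eq_bigr => a _; rewrite !mxE.
  have eT a : tnth theta a - ((Theta a)@_0%MM)%:MP =
      e (Theta a) + \sum_i ((Theta a)^`M(i))@_0%MM *: tnth psi i.
    by rewrite hTheta /e subrK.
  under eq_bigr do rewrite eT scalerDr.
  rewrite big_split /= -eS [e q]/e q0 mpolyC0 subr0; ring.
exfalso; have [a aH ha] := reflection_invariants_separate u v.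
have [C eC] := jets_mx char0 sHW (psi := psi) hgen aH (fun i => proj1 (psiH i)).
have := congr1 determinant eC; rewrite det_mulmx detZ eJ mulrA => /(mulIf J0) eD.
have := congr1 (act (1%:M + u *m v)) eD.
rewrite rmorphM /= QD mulr0 rmorphXn /= => /esym/eqP; rewrite expf_eq0 => /andP[_].
rewrite linearZ /= -mul_mpolyC mulf_eq0 mpolyC_eq0 (negPf (natr_neq0 char0 (cardG_gt0 _))) /=.
rewrite rmorph_prod => /prodf_eq0[y hy].
by rewrite rmorphXn expf_eq0 /= rmorphB /= subr_eq0 (negPf (ha y hy)).
Qed.

End Converse.

(** * Weighted homogeneous generators *)

Section Degrees.
Variables (k : fieldType) (n : nat) (mf : measure n).
Local Notation A := {mpoly k[n]}.

Lemma generators_degree_le (P Q : n.-tuple A) (eP eQ : 'I_n -> nat) :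
  (forall i, tnth P i \is (eP i).-homog for mf) ->
  (forall i, tnth Q i \is (eQ i).-homog for mf) ->
  (forall i, gen Q (tnth P i)) -> \det (jacobian P) != 0 ->
  exists s : 'S_n, forall i, (eQ (s i) <= eP i)%N.
Proof.
move=> hP hQ gQ J0; have [T0 hT0] := fin_all_exists gQ.
pose T i := pihomog (wgt eQ) (eP i) (T0 i).
have hT i : tnth P i = T i \mPo Q.
  rewrite -(pihomog_dE (hP i)) hT0; apply: pihomog_comp => j.
  by rewrite /= wgtU.
move: J0; rewrite (jacobian_comp hT) det_mulmx mulf_eq0 negb_or => /andP[D0 _].
have [s hs] : exists s : 'S_n, \prod_i ((T i)^`M(s i) \mPo Q) != 0.
  apply/existsP; apply: contraNT D0; rewrite negb_exists => /forallP z.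
  apply/eqP; apply: big1 => s _; have := z s; rewrite negbK => /eqP z0.
  by under eq_bigr do rewrite mxE; rewrite z0 mulr0.
exists s => i; move/prodf_neq0/(_ i isT): hs => ne.
have {}ne : (T i)^`M(s i) != 0 by apply: contraNneq ne => ->; rewrite comp_mpoly0.
have [mn] : exists mn, mn \in msupp (T i)^`M(s i).
  by move: ne; rewrite -msupp_eq0; case: (msupp _) => // mn ? _; exists mn; apply: mem_head.
rewrite mcoeff_msupp mcoeff_mderiv => ne'.
have : (mn + U_(s i))%MM \in msupp (T i).
  by rewrite mcoeff_msupp; apply: contraNneq ne' => ->; rewrite mul0rn.
by move/(dhomog_mf (pihomogP _ _ _)) => /= <-; rewrite wgtD wgtU leq_addl.
Qed.

Lemma generators_degree_perm (P Q : n.-tuple A) (eP eQ : 'I_n -> nat) :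
  (forall i, tnth P i \is (eP i).-homog for mf) ->
  (forall i, tnth Q i \is (eQ i).-homog for mf) ->
  (forall i, gen Q (tnth P i)) -> (forall i, gen P (tnth Q i)) ->
  \det (jacobian P) != 0 -> \det (jacobian Q) != 0 ->
  perm_eq [seq eP i | i <- enum 'I_n] [seq eQ i | i <- enum 'I_n].
Proof.
move=> hP hQ gQ gP JP JQ.
have [s hs] := generators_degree_le hP hQ gQ JP.
have [t ht] := generators_degree_le hQ hP gP JQ.
have es : \sum_i eP i = \sum_i eQ (s i).
  apply/eqP; rewrite eqn_leq [X in _ && X]leq_sum ?andbT => [|i _]; last exact: hs.
  have -> : \sum_i eQ (s i) = \sum_i eQ i by rewrite [RHS](reindex_inj (@perm_inj _ s)).
  rewrite [X in (X <= _)%N](reindex_inj (@perm_inj _ t)).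
  by apply: leq_sum => i _; apply: ht.
have : \sum_i eQ (s i) == \sum_i eP i by rewrite es.
have := leqif_sum (fun i (_ : xpredT i) => leqif_eq (hs i)) => -[_ ->] /forallP es'.
rewrite (_ : [seq eP i | i <- _] = [seq eQ i | i <- [seq s i | i <- enum 'I_n]]).
  apply: perm_map; apply: uniq_perm; last 1 first.
  - move=> i; rewrite [RHS]mem_enum; apply/mapP; exists (s^-1%g i); rewrite ?mem_enum //.
    by rewrite permKV.
  - by rewrite map_inj_uniq; [exact: enum_uniq | exact: perm_inj].
  - exact: enum_uniq.
rewrite -[RHS]map_comp; apply: eq_map => i; apply/eqP; rewrite eq_sym; exact: es'.
Qed.

End Degrees.

Section WeightedGenerators.
Variables (k : fieldType) (char0 : [pchar k] =i pred0).
Variables (gT : finGroupType) (W : {group gT}) (n : nat).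
Variable rW : mx_representation k W n.
Hypothesis faithW : mx_faithful rW.
Variable mf : measure n.
Local Notation A := {mpoly k[n]}.

Definition weighted_generators (T : seq (nat * A)) : Prop :=
  {in T, forall x, invariant rW W x.2 /\ x.2 \is x.1.-homog for mf} /\
  forall p, invariant rW W p -> gen (in_tuple (unzip2 T)) p.

Lemma weighted_generators_tuple T : weighted_generators T -> (size T <= n)%N ->
  exists (theta : n.-tuple A) (e : 'I_n -> nat),
  [/\ forall i, invariant rW W (tnth theta i),
      forall i, tnth theta i \is (e i).-homog for mf,
      forall p, invariant rW W p -> gen theta p &
      unzip1 T = [seq e i | i <- enum 'I_n]].
Proof.
move=> [hT gT0] le.
have ge := size_generators char0 faithW gT0; rewrite size_map in ge.
have eT : size T = n by apply/eqP; rewrite eqn_leq le ge.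
pose F i := nth (0%N, 0) T i.
have FT (i : 'I_n) : F i \in T by rewrite mem_nth // eT.
exists [tuple (F i).2 | i < n], (fun i => (F i).1); split=> [i|i|p Ip|].
- by rewrite tnth_mktuple; case: (hT _ (FT i)).
- by rewrite tnth_mktuple; case: (hT _ (FT i)).
- apply: (gen_seq (gen_subalg _) _ (gT0 p Ip)) => q /mapP[x /(nthP (0%N, 0))[i]].
  rewrite eT => lt <- ->; have := gen_tnth [tuple (F i).2 | i < n] (Ordinal lt).
  by rewrite tnth_mktuple.
apply: (@eq_from_nth _ 0%N) => [|i]; first by rewrite [LHS]size_map [RHS]size_map size_enum_ord.
rewrite size_map => lt; have lt' : (i < n)%N by rewrite -eT.
rewrite (nth_map (0%N, 0)) // (nth_map (Ordinal lt')) ?size_enum_ord //.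
by rewrite /F nth_enum_ord.
Qed.

Lemma weighted_generators_reflection T : weighted_generators T -> (size T <= n)%N ->
  W :=: <<[set s in W | reflection (rW s)]>>.
Proof.
move=> hT le; have [theta [e [thetaW _ gt _]]] := weighted_generators_tuple hT le.
exact: (reflection_generated char0 faithW thetaW gt).
Qed.

Lemma weighted_generators_perm S T :
  weighted_generators S -> weighted_generators T ->
  (size S <= n)%N -> (size T <= n)%N -> perm_eq (unzip1 S) (unzip1 T).
Proof.
move=> hS hT lS lT.
have [P [eP [PW hP gP ->]]] := weighted_generators_tuple hS lS.
have [Q [eQ [QW hQ gQ ->]]] := weighted_generators_tuple hT lT.
by apply: (generators_degree_perm hP hQ) => [i|i||]; auto;
   apply: (jacobian_neq0 char0 faithW).
Qed.

End WeightedGenerators.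

(** * The tangent representation *)

Section Relations.
Variables (k : fieldType) (n m : nat) (d : 'I_m -> nat) (f : m.-tuple {mpoly k[n]}).
Hypothesis d_gt0 : forall j, (0 < d j)%N.
Hypothesis fd : forall j, tnth f j \is (d j).-homog.
Local Notation A := {mpoly k[m]}.
Local Notation U := (@relations k n m f).
Local Notation U' := (@pos_relations k n m f).

Lemma wgt_gt0 i : (0 < wgt d U_(i)%MM)%N.
Proof. by rewrite wgtU. Qed.

Lemma relations_comp_pihomog p e :
  pihomog mdeg e (p \mPo f) = pihomog (wgt d) e p \mPo f.
Proof. by apply: pihomog_comp => j; rewrite /= wgtU. Qed.

Lemma relations_graded p e : U p -> U (pihomog (wgt d) e p).
Proof. by rewrite /relations -relations_comp_pihomog => ->; rewrite pihomog0. Qed.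

Lemma f_mcoeff0 j : (tnth f j)@_0%MM = 0.
Proof. by apply: (dhomog_nemf_coeff (fd j)); rewrite /= mdeg0 eq_sym -lt0n. Qed.

Lemma relations_mcoeff0 p : U p -> p@_0%MM = 0.
Proof. by move=> Up; rewrite -(mcoeff0_comp p f_mcoeff0) Up mcoeff0. Qed.

Lemma pos_relationsZ c p : U' p -> U' (c *: p).
Proof.
by apply: ideal_mulZ => q [_ q0]; split=> //; rewrite mcoeffZ q0 mulr0.
Qed.

Lemma pos_relationsN p : U' p -> U' (- p).
Proof. by rewrite -scaleN1r; apply: pos_relationsZ. Qed.

Lemma pos_relationsB p q : U' p -> U' q -> U' (p - q).
Proof. by move=> hp /pos_relationsN; apply: ideal_mulD. Qed.

Definition spans N (r : 'I_N -> A) : Prop :=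
  (forall j, U (r j)) /\
  forall p, U p -> exists c : 'I_N -> k, U' (p - \sum_j c j *: r j).

Lemma ideal_generates_spans (s : seq A) : ideal_generates U s ->
  spans (fun j : 'I_(size s) => s`_j).
Proof.
move=> [sU sgen]; split=> [j|p /sgen[c ->]]; first by apply: sU; apply: mem_nth.
exists (fun j => (c j)@_0%MM); rewrite -sumrB; apply: ideal_mul_sum => j _.
rewrite -mul_mpolyC -mulrBl; apply: ideal_mul_in; last by apply: sU; apply: mem_nth.
by split=> //; rewrite mcoeffB mcoeffC eqxx mulr1 subrr.
Qed.

Lemma spans_dependent c N (r : 'I_c -> A) (g : 'I_N -> A) :
  spans r -> (forall j, U (g j)) -> (c < N)%N ->
  exists2 v : 'rV[k]_N, v != 0 & U' (\sum_j v 0 j *: g j).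
Proof.
move=> [_ hr] gU lt; have [b hb] := fin_all_exists (fun j => hr _ (gU j)).
pose M := \matrix_(j, i) b j i : 'M[k]_(N, c).
have : kermx M != 0.
  rewrite -mxrank_eq0 mxrank_ker -lt0n subn_gt0.
  exact: leq_ltn_trans (rank_leq_col _) lt.
move=> /rowV0Pn[v /sub_kermxP vM v0]; exists v => //.
have -> : \sum_j v 0 j *: g j = \sum_j v 0 j *: (g j - \sum_i b j i *: r i).
  under [RHS]eq_bigr do rewrite scalerBr.
  rewrite sumrB [X in _ - X](_ : _ = 0) ?subr0 //.
  under eq_bigr do rewrite scaler_sumr.
  rewrite exchange_big big1 // => i _ /=.
  under eq_bigr do rewrite scalerA.
  rewrite -scaler_suml; have /rowP/(_ i) := vM; rewrite !mxE.
  by under eq_bigr do rewrite mxE; move=> ->; rewrite scale0r.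
by apply: ideal_mul_sum => j _; apply: pos_relationsZ.
Qed.

Lemma basis_mod_size c N (r : 'I_c -> A) (g : 'I_N -> A) :
  spans r -> basis_mod U U' g -> (N <= c)%N.
Proof.
move=> hr [gU gu]; rewrite leqNgt; apply/negP => lt.
have [v v0 vU] := spans_dependent hr gU lt.
have U0 : U 0 by rewrite /relations comp_mpoly0.
have [w [_ w1]] := gu 0 U0; case/negP: v0.
have wv : w = - v.
  by apply: w1; rewrite -sumrN; under eq_bigr do rewrite mxE scaleNr opprK; rewrite add0r.
rewrite -oppr_eq0 -wv; apply/eqP; apply: w1.
rewrite big1 ?subr0; first exact: ideal_mul0.
by move=> j _; rewrite mxE scale0r.
Qed.

Lemma homog_relations c (r : 'I_c -> A) : spans r ->
  exists N (g : 'I_N -> A) (e : 'I_N -> nat),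
  [/\ (N <= c)%N, spans g & forall j, g j \is (e j).-homog for (wgt d)].
Proof.
move=> hr; pose Q N := exists (g : 'I_N -> A) (e : 'I_N -> nat),
  spans g /\ forall j, g j \is (e j).-homog for (wgt d).
have [|N [[g [e [hg he]]] Nmin]] := @ex_minimal Q.
  pose M := \max_j mmeasure (wgt d) (r j).
  pose T := ('I_c * 'I_M)%type.
  pose ev (t : 'I_#|{: T}|) : T := enum_val t.
  exists #|{: T}|, (fun t => pihomog (wgt d) (ev t).2 (r (ev t).1)).
  exists (fun t => (ev t).2 : nat); split=> [|j]; last exact: pihomogP.
  split=> [j|p /(proj2 hr)[b hb]]; first by apply/relations_graded/(proj1 hr).
  exists (fun t => b (ev t).1).
  rewrite -(big_enum_val (fun t : T => b t.1 *: pihomog (wgt d) t.2 (r t.1))) /=.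
  rewrite -(pair_bigA _ (fun (i : 'I_c) (j : 'I_M) => b i *: pihomog (wgt d) j (r i))) /=.
  under eq_bigr => i _.
    rewrite -scaler_sumr -(@pihomog_partitionE _ _ (wgt d) M); first over.
    exact: (leq_bigmax i).
  by [].
exists N, g, e; split=> //; rewrite leqNgt; apply/negP => lt.
have [v /rV0Pn[j0 vj0] hv] := spans_dependent hr (proj1 hg) lt.
case: N lt g e hg he Nmin v j0 vj0 hv => // N lt g e hg he Nmin v j0 vj0 hv.
apply: (Nmin N) => //; exists (g \o lift j0), (e \o lift j0); split=> [|j]; last exact: he.
split=> [j|p /(proj2 hg)[b hb]]; first exact: (proj1 hg).
exists (fun j => b (lift j0 j) - b j0 / v 0 j0 * v 0 (lift j0 j)).
rewrite (bigD1_ord j0) //= in hb; rewrite (bigD1_ord j0) //= in hv.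
have -> : p - \sum_j (b (lift j0 j) - b j0 / v 0 j0 * v 0 (lift j0 j)) *: g (lift j0 j) =
   (p - (b j0 *: g j0 + \sum_i b (lift j0 i) *: g (lift j0 i))) +
   (b j0 / v 0 j0) *: (v 0 j0 *: g j0 + \sum_i v 0 (lift j0 i) *: g (lift j0 i)).
  under eq_bigr do rewrite scalerBl -scalerA.
  rewrite sumrB -scaler_sumr scalerDr scalerA divfK //.
  by move: (b j0 *: g j0) (\sum_(i < N) _) (_ *: \sum_(i < N) _) => x y z; ring.
by apply: ideal_mulD => //; apply: pos_relationsZ.
Qed.

Lemma relations_nakayama N (g : 'I_N -> A) (e : 'I_N -> nat) :
  spans g -> (forall j, g j \is (e j).-homog for (wgt d)) ->
  forall p, U p -> exists a : 'I_N -> A, p = \sum_j a j * g j.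
Proof.
move=> [gU hg] he; pose J p := exists a : 'I_N -> A, p = \sum_j a j * g j.
have J0 : J 0 by exists (fun=> 0); rewrite big1 // => j _; rewrite mul0r.
have JD p q : J p -> J q -> J (p + q).
  move=> [a ->] [b ->]; exists (fun j => a j + b j).
  by rewrite -big_split; apply: eq_bigr => j _; rewrite mulrDl.
have JM a p : J p -> J (a * p).
  move=> [b ->]; exists (fun j => a * b j).
  by rewrite mulr_sumr; apply: eq_bigr => j _; rewrite mulrA.
have Jg j : J (g j).
  exists (fun i => (i == j)%:R); rewrite (bigD1 j) //= eqxx mul1r big1 ?addr0 // => i.
  by move/negPf->; rewrite mul0r.
have JS I (r : seq I) (P : pred I) (F : I -> A) :
    (forall i, P i -> J (F i)) -> J (\sum_(i <- r | P i) F i).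
  by move=> h; apply: (big_ind J).
suff hom t p : U p -> p \is t.-homog for (wgt d) -> J p.
  move=> p Up; have [M ->] := mpoly_pihomog_sum (wgt d) p.
  by apply: JS => i _; apply: (hom i); [exact: relations_graded | exact: pihomogP].
elim/ltn_ind: t p => t IH p Up hp; have [b [s [hs e0]]] := hg p Up.
have {}e0 : p = \sum_j b j *: g j + \sum_(u <- s) u.1 * u.2 by rewrite -e0 addrC subrK.
rewrite -(pihomog_dE hp) e0 pihomogD; apply: JD; rewrite raddf_sum /=.
  apply: (JS) => j _; rewrite linearZ /= -mul_mpolyC; apply: (JM).
  have [et|ne] := eqVneq (e j) t; last by rewrite (pihomog_ne0 ne).
  by rewrite -et pihomog_dE.
rewrite big_seq; apply: (JS) => u us; have [[_ u10] u2U] := hs u us.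
rewrite pihomogM; apply: JS => i _; have [i0|i0] := posnP i.
  by rewrite i0 (pihomog0E u.1 wgt_gt0) u10 mpolyC0 mul0r.
apply: (JM); case: (ltngtP i t) => [lt|gt|->].
- apply: (IH (t - i)%N); last exact: pihomogP.
    by rewrite ltn_subrL i0 (ltn_trans i0).
  exact: relations_graded.
- by have := ltn_ord i; rewrite ltnS leqNgt gt.
- by rewrite subnn (pihomog0E u.2 wgt_gt0) (relations_mcoeff0 u2U) mpolyC0.
Qed.

End Relations.

Section TangentGroup.
Variables (k : fieldType) (char0 : [pchar k] =i pred0).
Variables (gT : finGroupType) (Wt G : {group gT}) (n : nat).
Variable rWt : mx_representation k Wt n.
Hypothesis faithWt : mx_faithful rWt.
Hypothesis nGW : G <| Wt.
Variables (m : nat) (d : 'I_m -> nat) (f : m.-tuple {mpoly k[n]}).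
Hypothesis hf : equivariant_splitting G rWt d f.
Variable rV : mx_representation k (Wt / G)%G m.
Hypothesis hrV : tangent_action rWt f rV.
Local Notation B := (invariant rWt G).
Local Notation W := (Wt / G)%G.
Local Notation A := {mpoly k[m]}.

Let sGW : G \subset Wt := normal_sub nGW.

Lemma quotientP w : w \in W -> exists2 x, x \in Wt & w = coset G x.
Proof. by case/morphimP => x _ Wx ->; exists x. Qed.

Lemma coset_in_quotient x : x \in Wt -> coset G x \in W.
Proof. exact: mem_quotient. Qed.

Lemma splitting_act x j : x \in Wt ->
  act (rWt x) (tnth f j) = \sum_(i < m) rV (coset G x) i j *: tnth f i.
Proof.
move=> Wx; have [_ _ _ equi] := hf; apply: equi; last exact: hrV.
split; first exact: repr_mx_unit.
move=> g Gg; exists (x * g * x^-1)%g.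
  have : (g ^ x^-1)%g \in G by rewrite memJ_norm // groupV (subsetP (normal_norm nGW)).
  by rewrite conjgE invgK mulgA.
by rewrite !repr_mxM ?repr_mxV ?groupM ?groupV // (subsetP sGW).
Qed.

Lemma comp_act x p : x \in Wt ->
  act (rWt x) (p \mPo f) = act (rV (coset G x)) p \mPo f.
Proof.
move=> Wx; rewrite !actE !comp_mpolyA; congr (_ \mPo _); apply: eq_from_tnth => j.
rewrite !tnth_mktuple -actE splitting_act // raddf_sum; apply: eq_bigr => i _ /=.
by rewrite comp_mpolyZ comp_mpolyX_tnth.
Qed.

Lemma tangent_respects w : w \in W -> respects (wgt d) (rV w).
Proof.
case/quotientP => x Wx ->{w} a b ne; rewrite /= !wgtU; apply/eqP; apply: contraNT ne => ne.
have [_ fd [_ fbasis] _] := hf.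
pose P := rV (coset G x); have e0 : \sum_(i < m | d i == d a) P i b *: tnth f i = 0.
  have := congr1 (pihomog mdeg (d a)) (splitting_act b Wx).
  rewrite pihomog_act; last exact: respects_mdeg.
  rewrite (pihomog_ne0 _ (fd b)) 1?eq_sym // raddf0 raddf_sum /= => /esym.
  rewrite (bigID (fun i => d i == d a)) /= [X in _ + X]big1 ?addr0 => [e1|i ni].
    rewrite -[RHS]e1; apply: eq_bigr => i /eqP di; by rewrite linearZ /= -di pihomog_dE.
  by rewrite linearZ /= (pihomog_ne0 _ (fd i)) ?scaler0.
have B0 : inv_pos G rWt 0.
  by split; rewrite ?mcoeff0 //; apply: (subalg0 (invariant_subalg _ _)).
have I0 : inv_pos2 G rWt 0 by apply: ideal_mul0.
have [c [_ c1]] := fbasis 0 B0.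
have z0 : c = 0.
  by apply: c1; rewrite big1 ?subr0 // => j _; rewrite mxE scale0r.
have /rowP/(_ a) : c = \row_j (if d j == d a then P j b else 0).
  apply: c1; rewrite (bigID (fun i => d i == d a)) /= [X in _ - (_ + X)]big1.
    under eq_bigr => i di do rewrite mxE di.
    by rewrite e0 addr0 subr0.
  by move=> i /negPf ni; rewrite mxE ni scale0r.
by rewrite z0 !mxE eqxx => <-.
Qed.

Lemma invariants_gen p : B p -> gen f p.
Proof.
have [dpos fd [_ fbasis] _] := hf.
have mdeg_pos (i : 'I_n) : (0 < mdeg U_(i)%MM)%N by rewrite mdeg1.
apply: (graded_generation mdeg_pos (invariant_subalg rWt G)
  (@invariant_gradedS _ _ _ _ rWt G) (gen_subalg f) (gen_graded fd)) => q qB.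
have [c [hc _]] := fbasis q qB.
exists (\sum_j c 0 j *: tnth f j), (q - \sum_j c 0 j *: tnth f j); split=> //.
  apply: (subalg_sum (gen_subalg f)) => j _; apply: (subalgZ (gen_subalg f)).
  exact: gen_tnth.
by rewrite addrC subrK.
Qed.

Lemma tangent_faithful : mx_faithful rV.
Proof.
apply/subsetP => w /rkerP[/quotientP[x Wx ->] e1]; apply/set1P/coset_id.
apply: (fixed_invariants_mem char0 faithWt sGW Wx) => p /invariants_gen[q ->].
by rewrite comp_act // e1 act1.
Qed.

Lemma comp_invariant p : invariant rV W p -> invariant rWt Wt (p \mPo f).
Proof. by move=> hp x Wx; rewrite comp_act // hp // coset_in_quotient. Qed.

Lemma comp_reynolds p : invariant rWt Wt (p \mPo f) -> reynolds rV p \mPo f = p \mPo f.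
Proof.
move=> hp; rewrite /reynolds comp_mpolyZ (raddf_sum (comp_mpoly f)) /=.
rewrite (eq_bigr (fun=> p \mPo f)) => [|w /quotientP[x Wx ->]]; last first.
  by rewrite -comp_act // hp.
by rewrite sumr_const -scaler_nat scalerA mulVf ?scale1r // (cardG_neq0 char0 (Wt / G)%G).
Qed.

Section Generators.
Variables (s : seq {mpoly k[n]}) (es : 'I_(size s) -> nat).
Hypothesis sgen : alg_generates (invariant rWt Wt) s.
Hypothesis hs : forall i, tnth (in_tuple s) i \is (es i).-homog.
Variables (N : nat) (r : 'I_N -> A) (er : 'I_N -> nat).
Hypothesis hr : spans f r.
Hypothesis her : forall j, r j \is (er j).-homog for (wgt d).
Hypothesis hW : {in W, forall w p, relations f p -> pos_relations f (act (rV w) p - p)}.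

Lemma relations_reynolds p : relations f p -> relations f (reynolds rV p).
Proof.
move=> hp; rewrite /relations comp_reynolds // hp.
exact: (subalg0 (invariant_subalg _ _)).
Qed.

Lemma reynolds_moves_pos p : relations f p -> pos_relations f (reynolds rV p - p).
Proof.
move=> hp; have {2}-> : p = (#|W|%:R)^-1 *: \sum_(w in W) p.
  by rewrite sumr_const -scaler_nat scalerA mulVf ?scale1r // (cardG_neq0 char0 (Wt / G)%G).
rewrite -scalerBr -sumrB; apply: pos_relationsZ; apply: ideal_mul_sum => w Ww.
exact: hW.
Qed.

Lemma spans_reynolds : spans f (fun j => reynolds rV (r j)).
Proof.
split=> [j|p hp]; first by apply/relations_reynolds/(proj1 hr).
have [c hc] := (proj2 hr) p hp; exists c.
have -> : p - \sum_j c j *: reynolds rV (r j) =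
  (p - \sum_j c j *: r j) - \sum_j c j *: (reynolds rV (r j) - r j).
  under [X in _ = _ - X]eq_bigr do rewrite scalerBr.
  by rewrite sumrB; ring.
apply: pos_relationsB => //; apply: ideal_mul_sum => j _; apply: pos_relationsZ.
exact/reynolds_moves_pos/(proj1 hr).
Qed.

Lemma tangent_generators : exists T,
  weighted_generators rV (wgt d) T /\
  unzip1 T = [seq es i | i <- enum 'I_(size s)] ++ [seq er j | j <- enum 'I_N].
Proof.
have [dpos fd _ _] := hf.
have resp : {in W, forall w, respects (wgt d) (rV w)} by exact: tangent_respects.
have sW := invariant_subalg rWt Wt; have sA := invariant_subalg rV W.
have sI i : invariant rWt Wt (tnth (in_tuple s) i).
  by case: sgen => h _; apply: h; apply: mem_tnth.
have [q0 hq0] := fin_all_exists (fun i => invariants_gen (invariantS sGW (sI i))).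
pose q i := pihomog (wgt d) (es i) (q0 i).
have hq i : tnth (in_tuple s) i = q i \mPo f.
  by rewrite -(pihomog_dE (hs i)) hq0 (relations_comp_pihomog fd).
pose qb i := reynolds rV (q i); pose rb j := reynolds rV (r j).
have hqb i : qb i \mPo f = tnth (in_tuple s) i.
  by rewrite comp_reynolds -hq //; apply: sI.
have rbU j : relations f (rb j) by apply: (proj1 spans_reynolds).
have homR p e : p \is e.-homog for (wgt d) -> reynolds rV p \is e.-homog for (wgt d).
  move=> hp; rewrite -(pihomog_dE hp) -reynolds_pihomog //; exact: pihomogP.
pose T := [seq (es i, qb i) | i <- enum 'I_(size s)] ++ [seq (er j, rb j) | j <- enum 'I_N].
exists T; split; last by rewrite /unzip1 map_cat -!map_comp.
split=> [x|].
  rewrite mem_cat => /orP[] /mapP[i _ ->] /=; split; try exact: reynolds_invariant.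
    by apply: homR; apply: pihomogP.
  exact: homR.
have sg := gen_subalg (in_tuple (unzip2 T)).
have qbg i : gen (in_tuple (unzip2 T)) (qb i).
  apply: gen_mem_seq; apply/mapP; exists (es i, qb i) => //.
  by rewrite mem_cat; apply/orP; left; apply: map_f; rewrite mem_enum.
have rbg j : gen (in_tuple (unzip2 T)) (rb j).
  apply: gen_mem_seq; apply/mapP; exists (er j, rb j) => //.
  by rewrite mem_cat; apply/orP; right; apply: map_f; rewrite mem_enum.
have gg : graded (wgt d) (gen (in_tuple (unzip2 T))).
  have he0 i : exists e, tnth (in_tuple (unzip2 T)) i \is e.-homog for (wgt d).
    have /mapP[x] := mem_tnth i (in_tuple (unzip2 T)).
    rewrite mem_cat => /orP[] /mapP[j _ ->] ->.
      by exists (es j); apply: homR; apply: pihomogP.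
    by exists (er j); apply: homR.
  have [e he] := fin_all_exists he0.
  exact: gen_graded he.
apply: (graded_generation (wgt_gt0 dpos) sA (invariant_graded resp) sg gg) => p [pI p0].
have [h eh] := proj2 sgen _ (comp_invariant pI).
pose qt := [tuple qb i | i < size s].
have hqt : gen (in_tuple (unzip2 T)) (h \mPo qt).
  by apply: (subalg_gen sg (f := qt)) => [i|]; [rewrite tnth_mktuple | exists h].
have qtI : invariant rV W (h \mPo qt).
  apply: (subalg_gen sA (f := qt)) => [i|]; last by exists h.
  by rewrite tnth_mktuple; apply: reynolds_invariant.
have pU : relations f (p - (h \mPo qt)).
  rewrite /relations comp_mpolyB eh comp_mpolyA.
  have -> : [tuple tnth qt i \mPo f | i < size s] = in_tuple s.
    by apply: eq_from_tnth => i; rewrite !tnth_mktuple hqb.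
  by rewrite subrr.
have [a ea] := relations_nakayama dpos fd spans_reynolds (fun j => homR _ _ (her j)) pU.
have ea' : p - (h \mPo qt) = \sum_j reynolds rV (a j) * rb j.
  rewrite -(reynolds_id char0 (subalgB sA pI qtI)) ea raddf_sum /=.
  apply: eq_bigr => j _; rewrite [a j * _]mulrC [RHS]mulrC.
  by apply: reynoldsM; apply: reynolds_invariant.
pose c j := (reynolds rV (a j))@_0%MM.
exists ((h \mPo qt) + \sum_j c j *: rb j), (\sum_j (reynolds rV (a j) - (c j)%:MP) * rb j).
split.
- by apply: (subalgD sg) => //; apply: (subalg_sum sg) => j _; apply: (subalgZ sg).
- apply: ideal_mul_sum => j _; apply: ideal_mul_in; split.
  + by apply: (subalgB sA); [apply: reynolds_invariant | apply: (subalgC sA)].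
  + by rewrite mcoeffB mcoeffC eqxx mulr1 subrr.
  + exact: reynolds_invariant.
  + exact: (relations_mcoeff0 dpos fd (rbU j)).
rewrite -addrA -big_split /= -[LHS](subrK (h \mPo qt)) addrC ea'; congr (_ + _).
by apply: eq_bigr => j _; rewrite mulrBl mul_mpolyC addrC subrK.
Qed.

End Generators.
End TangentGroup.

(** * The factors W_i *)

Section Blocks.
Variables (k : fieldType) (char0 : [pchar k] =i pred0).
Variables (gT : finGroupType) (Wt G : {group gT}) (m : nat) (d : 'I_m -> nat).
Variable rV : mx_representation k (Wt / G)%G m.
Hypothesis faithV : mx_faithful rV.
Local Notation W := (Wt / G)%G.
Hypothesis resp : {in W, forall w, respects (wgt d) (rV w)}.
Local Notation A := {mpoly k[m]}.
Local Notation Vi := (homog_part k d).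
Local Notation Wi := (homog_stab d rV).

Definition block_proj i : 'M[k]_m := diag_mx (\row_a (d a == i)%:R).
Local Notation P := block_proj.

Lemma mul_block_projl i r (M : 'M[k]_(m, r)) a b : (P i *m M) a b = (d a == i)%:R * M a b.
Proof. by rewrite mul_diag_mx !mxE. Qed.

Lemma mul_block_projr i r (M : 'M[k]_(r, m)) a b : (M *m P i) a b = M a b * (d b == i)%:R.
Proof. by rewrite mul_mx_diag !mxE. Qed.

Lemma block_proj_idem i : P i *m P i = P i.
Proof.
apply/matrixP => a b; rewrite mul_block_projl !mxE.
by case: (d a == i); rewrite ?mul1r // mul0r mul0rn.
Qed.

Lemma block_proj_orth i j : i != j -> P i *m P j = 0.
Proof.
move=> ne; apply/matrixP => a b; rewrite mul_block_projl !mxE.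
have [ab|ab] := eqVneq a b; last by rewrite mulr0n mulr0.
by have [->|_] := eqVneq (d a) i; rewrite ?mul0r // (negPf ne) mulr1n mulr0.
Qed.

Lemma row_block_proj i a : row a (P i) = (d a == i)%:R *: delta_mx 0 a.
Proof. by rewrite row_diag_mx mxE. Qed.

Lemma homog_partE i : (Vi i :=: P i)%MS.
Proof.
apply/eqmxP/andP; split.
  apply/sumsmx_subP => a /eqP da; rewrite genmxE.
  have -> : delta_mx 0 a = row a (P i) by rewrite row_block_proj da eqxx scale1r.
  exact: row_sub.
apply/row_subP => a; rewrite row_block_proj; have [da|_] := eqVneq (d a) i.
  by rewrite scale1r (sumsmx_sup a) ?da // genmxE.
by rewrite scale0r sub0mx.
Qed.

Lemma lt_degree_bound a : (d a < degree_bound d)%N.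
Proof. by rewrite ltnS; apply: (leq_bigmax a). Qed.

Lemma homog_complE i : (homog_compl k d i :=: 1%:M - P i)%MS.
Proof.
apply/eqmxP/andP; split.
  apply/sumsmx_subP => j ne; rewrite homog_partE.
  have -> : P j = P j *m (1%:M - P i) by rewrite mulmxBr mulmx1 block_proj_orth ?subr0.
  exact: submxMl.
apply/row_subP => a; rewrite linearB /= row1 row_block_proj.
have [da|ne] := eqVneq (d a) i; first by rewrite scale1r subrr sub0mx.
rewrite scale0r subr0 (sumsmx_sup (Ordinal (lt_degree_bound a))) //.
by rewrite (sumsmx_sup a) ?genmxE.
Qed.

Lemma block_proj_comm i w : w \in W -> rV w *m P i = P i *m rV w.
Proof.
move=> Ww; apply/matrixP => a b; rewrite mul_block_projl mul_block_projr mulrC.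
have [->|ne] := eqVneq (rV w a b) 0; first by rewrite !mulr0.
by have := resp Ww ne; rewrite /= !wgtU => ->.
Qed.

Lemma homog_part_module i : mxmodule rV (Vi i).
Proof.
rewrite (eqmx_module _ (homog_partE i)); apply/mxmoduleP => w Ww.
by rewrite -block_proj_comm // submxMl.
Qed.

Lemma homog_stabP i w : w \in Wi i <-> w \in W /\ rV w - 1%:M = P i *m (rV w - 1%:M).
Proof.
rewrite /= (eqmx_rstab _ (homog_complE i)) inE -subr_eq0.
have -> : (1%:M - P i) *m rV w - (1%:M - P i) = (1%:M - P i) *m (rV w - 1%:M).
  by rewrite mulmxBr mulmx1.
rewrite mulmxBl mul1mx subr_eq0; split=> [/andP[Ww /eqP e]|[Ww e]] //.
by rewrite Ww -e eqxx.
Qed.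

Lemma homog_stab_sub i : Wi i \subset W.
Proof. exact: rstab_sub. Qed.

Lemma homog_stab_fix i j w : i != j -> w \in Wi j -> P i *m rV w = P i.
Proof.
move=> ne /homog_stabP[Ww e]; apply/eqP; rewrite -subr_eq0 -[X in _ - X]mulmx1 -mulmxBr.
by rewrite e mulmxA block_proj_orth ?mul0mx.
Qed.

Lemma block_fix_eq1 i w : w \in Wi i -> P i *m rV w = P i -> w = 1%g.
Proof.
move=> /homog_stabP[Ww e] fix_w; apply: (mx_faithful_inj faithV) => //.
rewrite repr_mx1; apply/eqP; rewrite -subr_eq0 e mulmxBr mulmx1 fix_w.
by rewrite subrr.
Qed.

Lemma reflection_homog_stab w : w \in W -> reflection (rV w) ->
  exists i : 'I_(degree_bound d), w \in Wi i.
Proof.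
move=> Ww /reflectionP[u u0 [v ew]].
have N a b : (rV w - 1%:M) a b = u a 0 * v 0 b.
  by rewrite ew addrC addKr mxE big_ord1.
have Nresp a b : u a 0 * v 0 b != 0 -> d a = d b.
  rewrite -N !mxE; have [->//|ab] := eqVneq a b; rewrite subr0 => ne.
  by have := resp Ww ne; rewrite /= !wgtU.
have [v0|v0] := eqVneq v 0.
  have w1 : w = 1%g.
    by apply: (mx_faithful_inj faithV) => //; rewrite repr_mx1 ew v0 mulmx0 addr0.
  by exists ord0; rewrite w1 group1.
have /cV0Pn[a ua] := u0; have /rV0Pn[b vb] := v0.
exists (Ordinal (lt_degree_bound a)); apply/homog_stabP; split=> //=.
apply/matrixP => a' b'; rewrite mul_block_projl N.
have [|ne] := eqVneq (d a') (d a); first by rewrite mul1r.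
have [->|ua'] := eqVneq (u a' 0) 0; first by rewrite !mul0r.
case/eqP: ne; rewrite (Nresp a' b) ?mulf_neq0 //.
by rewrite -(Nresp a b) ?mulf_neq0.
Qed.

Lemma homog_stab_centralises i j : i != j -> Wi i \subset 'C(Wi j).
Proof.
move=> ne; apply/centsP => x /homog_stabP[Wx ex] y /homog_stabP[Wy ey].
apply: (mx_faithful_inj faithV); rewrite ?groupM // !repr_mxM //.
have N0 a b (M N : 'M[k]_m) : a != b -> N = P b *m N ->
    M *m P a = P a *m M -> M = P a *m M -> M *m N = 0.
  move=> ab eN cM eM; rewrite eM -cM eN -mulmxA [P a *m (P b *m N)]mulmxA.
  by rewrite block_proj_orth // mul0mx mulmx0.
have comm a w : w \in W -> (rV w - 1%:M) *m P a = P a *m (rV w - 1%:M).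
  by move=> Ww; rewrite mulmxBl mulmxBr block_proj_comm // mulmx1 mul1mx.
have xy := N0 i j _ _ ne ey (comm i x Wx) ex.
have ne' : j != i by rewrite eq_sym.
have yx := N0 j i _ _ ne' ex (comm j y Wy) ey.
rewrite -[rV x](subrK 1%:M) -[rV y](subrK 1%:M).
move: (rV x - 1%:M) (rV y - 1%:M) xy yx => M N xy yx.
by rewrite !mulmxDl !mulmxDr xy yx !mul1mx !mulmx1 !add0r addrA [M + N]addrC -addrA.
Qed.

Lemma homog_stab_dprod : W :=: <<[set s in W | reflection (rV s)]>> ->
  \big[dprod/1%g]_(i < degree_bound d) Wi i = W.
Proof.
move=> genW.
have -> : \big[dprod/1%g]_(i < degree_bound d) Wi i = (\prod_(i < degree_bound d) Wi i)%G.
  apply/eqP/bigdprodYP => i _; rewrite subsetD; apply/andP; split.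
    by rewrite bigprodGE gen_subG; apply/bigcupsP => j /= ne; apply: homog_stab_centralises.
  have sfix : (\prod_(j < degree_bound d | j != i) Wi j)%G \subset rstab rV (P i).
    rewrite bigprodGE gen_subG; apply/bigcupsP => j ne; apply/subsetP => w hw.
    rewrite inE (subsetP (homog_stab_sub j)) //=.
    by rewrite (homog_stab_fix _ hw) // eq_sym.
  rewrite -setI_eq0; apply/eqP/setP => w; rewrite in_setI in_setD1 in_set0.
  apply/negP => /andP[/(subsetP sfix) hw /andP[/negP w1 wi]]; apply: w1.
  move: hw; rewrite inE => /andP[_ /eqP hw].
  by rewrite (block_fix_eq1 wi hw).
apply/eqP; rewrite eqEsubset bigprodGE gen_subG; apply/andP; split.
  by apply/bigcupsP => i _; apply: homog_stab_sub.
have /subset_trans -> // : W \subset <<[set s in W | reflection (rV s)]>> by rewrite -genW.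
rewrite gen_subG; apply/subsetP => w; rewrite inE => /andP[Ww rw].
have [i wi] := reflection_homog_stab Ww rw; apply: mem_gen; apply/bigcupP.
by exists i.
Qed.

Section Factor.
Variable i : nat.
Hypothesis hV : mxmodule rV (Vi i).
Local Notation r := (\rank (Vi i)).
Local Notation h := (homog_repr hV).

Definition block_val : 'M[k]_(r, m) := val_submod (U := Vi i) 1%:M.
Definition block_in : 'M[k]_(m, r) := in_submod (Vi i) (P i).

Lemma block_in_val : block_in *m block_val = P i.
Proof. by rewrite /block_val -val_submodE in_submodK // homog_partE. Qed.

Lemma block_proj_in : P i *m block_in = block_in.
Proof. by rewrite /block_in in_submodE mulmxA block_proj_idem -in_submodE. Qed.

Lemma block_val_proj : block_val *m P i = block_val.
Proof.
have /submxP[D e] : (block_val <= P i)%MS by rewrite -homog_partE val_submodP.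
by rewrite e -mulmxA block_proj_idem.
Qed.

Lemma block_val_in : block_val *m block_in = 1%:M.
Proof.
by rewrite /block_in in_submodE mulmxA block_val_proj -in_submodE val_submodK.
Qed.

Lemma block_in_act w : w \in W -> rV w *m block_in = block_in *m h w.
Proof.
move=> Ww; rewrite /block_in -(in_submodJ hV) ?homog_partE //.
by rewrite [in LHS]in_submodE mulmxA block_proj_comm // -in_submodE.
Qed.

Lemma block_val_act w : w \in W -> h w *m block_val = block_val *m rV w.
Proof.
by move=> Ww; rewrite /block_val -val_submodE -(val_submodJ hV) // mul1mx.
Qed.

Lemma homog_repr_reflection w : w \in Wi i -> reflection (h w) = reflection (rV w).
Proof.
move=> /homog_stabP[Ww e]; rewrite !reflection_rank; congr (_ == _); apply/eqP.
have e1 : h w - 1%:M = block_val *m (rV w - 1%:M) *m block_in.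
  rewrite mulmxBr mulmx1 mulmxBl block_val_in -block_val_act // -mulmxA.
  by rewrite block_val_in mulmx1.
have e2 : rV w - 1%:M = block_in *m (h w - 1%:M) *m block_val.
  by rewrite mulmxBr mulmx1 mulmxBl block_in_val -block_in_act // -mulmxA block_in_val
    block_proj_comm // -[X in _ = _ - X]mulmx1 -mulmxBr.
rewrite eqn_leq; apply/andP; split; [rewrite e1 | rewrite e2];
  by apply: leq_trans (mxrankM_maxl _ _) (mxrankM_maxr _ _).
Qed.

Lemma homog_repr_faithful : mx_faithful h.
Proof.
apply/subsetP => w /rkerP[wi e1]; apply/set1P; apply: (block_fix_eq1 wi).
have [Ww _] := (homog_stabP i w).1 wi.
by rewrite -block_proj_comm // -block_in_val mulmxA block_in_act // e1 mulmx1.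
Qed.

Lemma homog_stab_generated : W :=: <<[set s in W | reflection (rV s)]>> ->
  Wi i :=: <<[set s in Wi i | reflection (h s)]>>.
Proof.
move=> genW; pose K := <<[set s in Wi i | reflection (h s)]>>%G; apply/eqP.
rewrite eqEsubset; apply/andP; split; last first.
  by rewrite gen_subG; apply/subsetP => s; rewrite inE => /andP[].
have sKW : K \subset W.
  rewrite gen_subG; apply/subsetP => s; rewrite inE => /andP[+ _].
  exact: (subsetP (homog_stab_sub i)).
have modP : mxmodule rV (P i) by rewrite -(eqmx_module _ (homog_partE i)).
pose C := rstab_group rV (P i).
have sWKC : W \subset (K * C)%g.
  rewrite -norm_joinEl; last exact: subset_trans sKW (rstab_norm modP).
  have /subset_trans -> // : W \subset <<[set s in W | reflection (rV s)]>>.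
    by rewrite -genW.
  rewrite gen_subG; apply/subsetP => s; rewrite inE => /andP[Ws rs].
  have [j sj] := reflection_homog_stab Ws rs.
  have [ij|ij] := eqVneq i j.
    have si : s \in Wi i by rewrite ij.
    rewrite mem_gen // inE; apply/orP; left; apply: mem_gen.
    by rewrite inE si /= homog_repr_reflection.
  rewrite mem_gen // inE; apply/orP; right.
  by rewrite inE Ws /= (homog_stab_fix ij sj).
apply/subsetP => w wi; have Ww := subsetP (homog_stab_sub i) w wi.
have /mulsgP[y c Ky Cc ew] := subsetP sWKC w Ww.
have yi : y \in Wi i.
  apply: subsetP Ky; rewrite gen_subG; apply/subsetP => s.
  by rewrite inE => /andP[].
have ci : c \in Wi i by rewrite -(groupMl c yi) -ew.
have := Cc; rewrite inE => /andP[_ /eqP fixc].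
by rewrite ew (block_fix_eq1 ci fixc) mulg1.
Qed.

End Factor.

End Blocks.

Lemma invariant_generated (k : fieldType) (gT : finGroupType) (G : {group gT}) n
    (rG : mx_representation k G n) (S : {set gT}) p :
  S \subset G -> invariant rG S p -> invariant rG <<S>> p.
Proof.
move=> sSG hS x /gen_prodgP[l [c hc ->]]; elim: l c hc => [|l IH] c hc.
  by rewrite big_ord0 act_repr1.
rewrite big_ord_recl -act_repr; first by rewrite IH // hS.
  exact: (subsetP sSG).
by apply: group_prod => i _; apply: (subsetP sSG).
Qed.

Section Lifts.
Variables (k : fieldType) (char0 : [pchar k] =i pred0).
Variables (gT : finGroupType) (Wt G : {group gT}) (m : nat) (d : 'I_m -> nat).
Variable rV : mx_representation k (Wt / G)%G m.
Hypothesis faithV : mx_faithful rV.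
Local Notation W := (Wt / G)%G.
Hypothesis resp : {in W, forall w, respects (wgt d) (rV w)}.
Hypothesis genW : W :=: <<[set s in W | reflection (rV s)]>>.
Local Notation A := {mpoly k[m]}.
Local Notation Vi := (homog_part k d).
Local Notation Wi := (homog_stab d rV).
Local Notation P := (block_proj k d).
Local Notation b := (degree_bound d).

(* The polynomial functions of the coordinates of degree i *)
Definition block_poly i (p : A) : Prop := p \mPo lin (P i) = p.

Lemma block_poly_fixed i j p : i != j -> block_poly j p -> invariant rV (Wi i) p.
Proof.
move=> ne pj w wi; have Ww := subsetP (homog_stab_sub d rV i) w wi.
rewrite -{1}pj actE lin_comp block_proj_comm //.
by rewrite (homog_stab_fix _ wi) // eq_sym.
Qed.

Lemma block_poly_reynolds i p :
  block_poly i p -> block_poly i (reynolds (subg_repr rV (homog_stab_sub d rV i)) p).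
Proof.
move=> hp; rewrite /block_poly /reynolds comp_mpolyZ (raddf_sum (comp_mpoly _)) /=.
congr (_ *: _); apply: eq_bigr => w wi.
have Ww := subsetP (homog_stab_sub d rV i) w wi.
by rewrite actE lin_comp -block_proj_comm // -lin_comp hp.
Qed.

Definition block_span (L : seq 'I_b) (p : A) : Prop :=
  forall Q : A -> Prop, Q 0 -> (forall p1 p2, Q p1 -> Q p2 -> Q (p1 + p2)) ->
  (forall c p1, Q p1 -> Q (c *: p1)) ->
  (forall F : 'I_b -> A, (forall j : 'I_b, block_poly j (F j)) ->
     {in L, forall j : 'I_b, invariant rV (Wi j) (F j)} -> Q (\prod_j F j)) -> Q p.

Lemma block_span_nil p : block_span [::] p.
Proof.
move=> Q Q0 QD QZ QF; apply: (mpoly_mono_ind (P := Q)) => // mn.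
rewrite mpolyXE_id (partition_big (fun a => Ordinal (lt_degree_bound d a)) xpredT) //=.
apply: QF => // j; rewrite /block_poly rmorph_prod /=; apply: eq_bigr => a /eqP <-.
rewrite rmorphXn /= -linform_delta linform_comp; congr (linform _ ^+ _).
apply/matrixP => x y; rewrite mul_block_projl mxE ord1 eqxx andbT /=.
by have [->|_] := eqVneq x a; rewrite ?eqxx ?mul1r ?mulr0.
Qed.

Lemma block_span_cons (i : 'I_b) L p :
  invariant rV (Wi i) p -> block_span L p -> block_span (i :: L) p.
Proof.
pose rWi := subg_repr rV (homog_stab_sub d rV i).
move=> pI hp Q Q0 QD QZ QF; rewrite -(reynolds_id (rG := rWi) char0 pI).
apply: (hp (fun p => Q (reynolds rWi p))) => [|p1 p2 Q1 Q2|c p1 Q1|F hF hL].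
- by rewrite raddf0.
- by rewrite raddfD; apply: QD.
- by rewrite linearZ; apply: QZ.
have -> : reynolds rWi (\prod_j F j) =
    \prod_j (if j == i then reynolds rWi (F j) else F j).
  rewrite [RHS](bigD1 i) //= eqxx (bigD1 i) //= mulrC [RHS]mulrC reynoldsM.
    by congr (_ * _); apply: eq_bigr => j /negPf ->.
  apply: (subalg_prod (invariant_subalg rWi (Wi i))) => j ne.
  by apply: (block_poly_fixed (j := j)) => //; rewrite eq_sym.
apply: QF => [j|j].
  by case: eqP => [->|_] //; apply: block_poly_reynolds.
case: eqP => [-> _|ne]; first exact: (reynolds_invariant rWi).
by rewrite inE => /orP[/eqP//|/hL].
Qed.

Lemma invariants_block_generated (B : A -> Prop) : subalg B ->
  (forall (i : 'I_b) p, block_poly i p -> invariant rV (Wi i) p -> B p) ->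
  forall p, invariant rV W p -> B p.
Proof.
move=> sB hB p pI.
have : block_span (enum 'I_b) p.
  elim: (enum 'I_b) => [|i L IH]; first exact: block_span_nil.
  by apply: block_span_cons => //; apply: invariantS pI; apply: homog_stab_sub.
apply=> [|p1 p2|c p1|F hF hL].
- exact: (subalg0 sB).
- exact: (subalgD sB).
- exact: (subalgZ sB).
by apply: (subalg_prod sB) => j _; apply: (hB j) => //; apply: hL; rewrite mem_enum.
Qed.

Lemma lift_generators i (hV : mxmodule rV (Vi i)) (E : seq nat) :
  group_degrees (homog_repr hV) E ->
  exists T : seq (nat * A),
  [/\ {in T, forall x, invariant rV W x.2 /\ x.2 \is x.1.-homog for (wgt d)},
      unzip1 T = [seq (i * e)%N | e <- E], (size T <= \rank (Vi i))%N &
      forall p, block_poly i p -> invariant rV (Wi i) p -> gen (in_tuple (unzip2 T)) p].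
Proof.
move=> [s [smin hs]]; have [[sI sgen] _] := smin.
have shom : all_homog s.
  by move=> p /tnthP[j ->]; exists (nth 0%N E j).
have le := size_min_generators char0 (homog_stab_generated faithV resp hV genW) smin shom.
pose lift (q : {mpoly k[\rank (Vi i)]}) : A := q \mPo lin (block_in k d i).
pose T := [seq ((i * nth 0%N E (j : 'I_(size E)))%N, lift (tnth s j)) | j <- enum 'I_(size E)].
have liftI q : invariant (homog_repr hV) (Wi i) q -> invariant rV W (lift q).
  move=> qI; suff : invariant rV [set x in W | reflection (rV x)] (lift q).
    move/invariant_generated; rewrite -genW; apply.
    by apply/subsetP => x; rewrite inE => /andP[].
  move=> x; rewrite inE => /andP[Wx rx]; rewrite actE lin_comp.
  have [j xj] := reflection_homog_stab faithV resp Wx rx.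
  have [ij|ij] := eqVneq i j.
    have xi : x \in Wi i by rewrite ij.
    by rewrite (block_in_act resp hV) // -lin_comp -actE qI.
  have -> : rV x *m block_in k d i = block_in k d i; last by [].
  rewrite -{1}block_proj_in mulmxA block_proj_comm //.
  by rewrite (homog_stab_fix ij xj) block_proj_in.
exists T; split.
- move=> x /mapP[j _ ->] /=; split; first by apply/liftI/sI/mem_tnth.
  have hq : tnth s j \is (i * nth 0%N E j).-homog for (wgt (fun _ : 'I_(\rank (Vi i)) => i)).
    apply/dhomogP => mn /(dhomog_mf (hs j)) /= <-.
    by rewrite mdegE /wgt big_distrr.
  rewrite /lift -(pihomog_dE hq) -(@pihomog_comp _ _ _ _ (wgt d)); first exact: pihomogP.
  move=> a; rewrite tnth_lin /= wgtU; apply: linform_homog => c.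
  rewrite mxE -block_proj_in mul_block_projl /= wgtU.
  by have [//|_] := eqVneq (d c) i; rewrite mul0r eqxx.
- rewrite /unzip1 -map_comp; apply: (@eq_from_nth _ 0%N) => [|j].
    by rewrite [LHS]size_map [RHS]size_map size_enum_ord.
  rewrite [X in (_ < X)%N]size_map size_enum_ord => lt.
  rewrite (nth_map (Ordinal lt)) ?size_enum_ord // (nth_map 0%N) //=.
  by rewrite nth_enum_ord.
- by rewrite /T size_map size_enum_ord; rewrite size_tuple in le.
move=> p pp pI; pose q := p \mPo lin (block_val k d i).
have qI : invariant (homog_repr hV) (Wi i) q.
  move=> w wi; have Ww := subsetP (homog_stab_sub d rV i) w wi.
  by rewrite /q actE lin_comp (block_val_act hV) // -lin_comp -actE pI.
have -> : p = lift q by rewrite /lift /q lin_comp block_in_val.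
have [h ->] := sgen q qI; rewrite /lift comp_mpolyA.
apply: (subalg_gen (gen_subalg _) (f := [tuple tnth (in_tuple s) j \mPo lin (block_in k d i) | j < size s])); last by exists h.
move=> j; rewrite tnth_mktuple; apply: gen_mem_seq.
have /tnthP[j' ->] : tnth (in_tuple s) j \in s by apply: mem_tnth.
by rewrite /unzip2 -map_comp; apply: map_f; rewrite mem_enum.
Qed.

Lemma lift_all_generators (hV : forall i, mxmodule rV (Vi i)) (E : nat -> seq nat) :
  (forall i, group_degrees (homog_repr (hV i)) (E i)) -> forall L : seq nat,
  exists T : seq (nat * A),
  [/\ {in T, forall x, invariant rV W x.2 /\ x.2 \is x.1.-homog for (wgt d)},
      unzip1 T = flatten [seq [seq (i * e)%N | e <- E i] | i <- L],
      (size T <= \sum_(i <- L) \rank (Vi i))%N &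
      forall i p, i \in L -> block_poly i p -> invariant rV (Wi i) p ->
        gen (in_tuple (unzip2 T)) p].
Proof.
move=> hE; elim=> [|i L [T [hT eT sT gT0]]].
  by exists [::]; split=> //; rewrite big_nil.
have [S [hS eS sS gS]] := lift_generators (hE i).
have sub (T1 T2 : seq (nat * A)) p : {subset T1 <= T2} ->
    gen (in_tuple (unzip2 T1)) p -> gen (in_tuple (unzip2 T2)) p.
  move=> s12; apply: (gen_seq (gen_subalg _)) => q /mapP[x xT ->].
  by apply/gen_mem_seq/map_f/s12.
exists (S ++ T); split=> [x||| j p].
- by rewrite mem_cat => /orP[/hS|/hT].
- by rewrite /unzip1 map_cat /= -eT -eS.
- by rewrite size_cat big_cons leq_add.
rewrite inE => /orP[/eqP->|jL] pp pI.
  by apply: (sub S); [move=> x xS; rewrite mem_cat xS | apply: gS].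
by apply: (sub T); [move=> x xT; rewrite mem_cat xT orbT | apply: (gT0 j)].
Qed.

Lemma sum_rank_homog_part : (\sum_(i <- iota 0 b) \rank (Vi i) <= m)%N.
Proof.
have le i : (\rank (Vi i) <= \sum_(a < m | d a == i) 1)%N.
  apply: leq_trans (mxrank_sum_leqif _).1 _ => /=.
  by apply: leq_sum => a _; rewrite genmxE rank_leq_row.
apply: leq_trans (leq_sum _ (fun i _ => le i)) _.
rewrite -[iota 0 b]/(index_iota 0 b) big_mkord.
rewrite -[X in (_ <= X)%N]card_ord -sum1_card.
rewrite [X in (_ <= X)%N](partition_big (fun a => Ordinal (lt_degree_bound d a)) xpredT) //=.
Qed.

Lemma lift_weighted_generators (hV : forall i, mxmodule rV (Vi i)) (E : nat -> seq nat) :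
  (forall i, group_degrees (homog_repr (hV i)) (E i)) ->
  exists T, [/\ weighted_generators rV (wgt d) T, (size T <= m)%N &
    unzip1 T = flatten [seq [seq (i * e)%N | e <- E i] | i <- iota 0 b]].
Proof.
move=> hE; have [T [hT eT sT gT0]] := lift_all_generators hE (iota 0 b).
exists T; split=> //; last exact: leq_trans sT sum_rank_homog_part.
split=> //; apply: (invariants_block_generated (gen_subalg _)) => i p.
by apply: gT0; rewrite mem_iota /=.
Qed.

End Lifts.

Lemma map_nth_enum_ord (E : seq nat) l : size E = l ->
  [seq nth 0%N E i | i : 'I_l <- enum 'I_l] = E.
Proof.
move=> sE; apply: (@eq_from_nth _ 0%N) => [|i]; first by rewrite size_map size_enum_ord.
rewrite size_map size_enum_ord => lt.
by rewrite (nth_map (Ordinal lt)) ?size_enum_ord // nth_enum_ord.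
Qed.

Lemma size_map_enum_ord (T : Type) l (F : 'I_l -> T) : size [seq F i | i <- enum 'I_l] = l.
Proof. by rewrite size_map size_enum_ord. Qed.

Theorem proposition3p16
    (k : fieldType) (char0 : [pchar k] =i pred0)
    (gT : finGroupType) (Wt G : {group gT}) (n : nat)
    (rWt : mx_representation k Wt n)
    (hWt : reflection_group rWt)
    (nGW : G <| Wt)
    (m : nat) (d : 'I_m -> nat) (f : m.-tuple {mpoly k[n]})
    (hf : equivariant_splitting G rWt d f)
    (rV : mx_representation k (Wt / G)%G m)
    (hrV : tangent_action rWt f rV)
    (hG : good f rV) :
  exists hV : forall i : nat, mxmodule rV (homog_part k d i),
    [/\ \big[dprod/1%g]_(i < degree_bound d) homog_stab d rV i = (Wt / G)%g,
        forall i : nat, reflection_group (homog_repr (hV i)) &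
        forall (Et : seq nat) (R : seq nat) (E : nat -> seq nat),
          group_degrees rWt Et ->
          relation_degrees d f R ->
          (forall i : nat, group_degrees (homog_repr (hV i)) (E i)) ->
          perm_eq
            (flatten [seq [seq (i * e)%N | e <- E i]
                     | i <- iota 0 (degree_bound d)])
            (Et ++ R)].
Proof.
have [faithWt genWt] := hWt.
have [[c nc [[r0 sr0 gr0] _]] hW] := hG.
have spans0 : spans f (fun j : 'I_(size r0) => r0`_j) by apply: ideal_generates_spans.
have [_ fd _ _] := hf.
have faithV := tangent_faithful char0 faithWt nGW hf hrV.
have resp := tangent_respects nGW hf hrV.
have genW : (Wt / G)%G :=: <<[set s in (Wt / G)%G | reflection (rV s)]>>.
  have [N [r [er [le hr her]]]] := homog_relations fd spans0.
  have [s [smin shom]] := invariants_min_gens char0 rWt.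
  have les := size_min_generators char0 genWt smin shom.
  have [es hes] := fin_all_exists (fun i => shom _ (mem_tnth i (in_tuple s))).
  have [T [hT eT]] := tangent_generators char0 nGW hf hrV (proj1 smin) hes hr her hW.
  apply: (weighted_generators_reflection char0 faithV hT).
  rewrite -(size_map fst) -/(unzip1 T) eT size_cat !size_map_enum_ord.
  by rewrite -nc leq_add // -sr0.
exists (homog_part_module resp); split.
- exact: homog_stab_dprod.
- by move=> i; split; [apply: homog_repr_faithful | apply: homog_stab_generated].
move=> Et R E [s [smin hs]] [r [[rU rbasis] hr]] hE.
have shom : all_homog s by move=> p /tnthP[j ->]; exists (nth 0%N Et j).
have les := size_min_generators char0 genWt smin shom.
have leR := basis_mod_size spans0 (conj rU rbasis).
have spansR : spans f r.
  split=> // p /rbasis[b [hb _]]; exists (fun j => b 0 j).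
  exact: hb.
have sE : size s = size Et by rewrite size_tuple.
have hes (i : 'I_(size s)) : tnth (in_tuple s) i \is (nth 0%N Et i).-homog.
  have lt : (i < size Et)%N := leq_trans (ltn_ord i) (eq_leq sE).
  by have := hs (Ordinal lt); rewrite !(tnth_nth 0).
have hR j : r j \is (nth 0%N R j).-homog for (wgt d) by apply/dhomogP/hr.
have [T1 [hT1 eT1]] := tangent_generators char0 nGW hf hrV (proj1 smin) hes spansR hR hW.
rewrite !map_nth_enum_ord // in eT1.
have [T2 [hT2 le2 eT2]] := lift_weighted_generators char0 faithV resp genW hE.
rewrite -eT2 -eT1; apply: (weighted_generators_perm char0 faithV hT2 hT1 le2).
rewrite -(size_map fst) -/(unzip1 T1) eT1 size_cat -nc leq_add //; last by rewrite -sr0.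
exact: leq_trans (eq_leq (esym sE)) les.
Qed.
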